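(* Let $n$ be a positive integer. Suppose $A\in\mathbb{C}^{n\times n}$ and $\delta\in(0,1)$. Then there is a matrix $E\in\mathbb{C}^{n\times n}$ such that $\|E\|\le\delta\|A\|$ and $$\kappa_V(A+E)\le 4n^{3/2}\left(1+\frac{1}{\delta}\right).$$
   Context: $\|\cdot\|$ denotes the operator norm (spectral norm) of a matrix. For $M\in\mathbb{C}^{n\times n}$, the eigenvector condition number is $$\kappa_V(M)=\inf_{V:\,M=VDV^{-1}}\|V\|\,\|V^{-1}\|,$$ where the infimum is over all invertible $V\in\mathbb{C}^{n\times n}$ for which $M=VDV^{-1}$ with $D$ diagonal; $\kappa_V(M)=\infty$ if $M$ is not diagonalizable. *)

(* Defs.v *)
From mathcomp Require Import all_boot all_order all_algebra.
From mathcomp Require Import all_classical all_reals all_analysis.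
From mathcomp Require Import complex.
Set Implicit Arguments.
Unset Strict Implicit.
Unset Printing Implicit Defensive.
Import Order.TTheory GRing.Theory Num.Theory.

Local Open Scope classical_set_scope.
Local Open Scope ring_scope.

(* The library's norm on matrices is the max norm, hence the definitions of the
   Euclidean norm and of the norm it induces on matrices. *)
Definition l2norm (R : realType) (n : nat) (v : 'cV[R[i]]_n) : R :=
  Num.sqrt (\sum_(i < n) Normc.normc (v i 0) ^+ 2).

Definition opnorm (R : realType) (n : nat) (M : 'M[R[i]]_n) : R :=
  sup [set l2norm (M *m v) | v in [set v | l2norm v <= 1]].

(* [ereal_inf] of the empty set is [+oo], so [kappaV M = +oo] when [M] is not
   diagonalizable. *)
Definition kappaV (R : realType) (n : nat) (M : 'M[R[i]]_n) : \bar R :=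
  ereal_inf [set x | exists V D : 'M[R[i]]_n,
    [/\ V \in unitmx, is_diag_mx D, M = V *m D *m invmx V
      & x = (opnorm V * opnorm (invmx V))%:E]].

(* [sup] is only meaningful on nonempty bounded sets. *)
Lemma has_sup_opnorm (R : realType) (n : nat) (M : 'M[R[i]]_n) :
  has_sup [set l2norm (M *m v) | v in [set v | l2norm v <= 1]].
Proof.
have nn (z : R[i]) : 0 <= Normc.normc z by case: z => *; apply: sqrtr_ge0.
split.
  exists (l2norm (M *m 0)), 0 => //=.
  rewrite /l2norm big1 ?sqrtr0 ?ler01 // => i _.
  by rewrite mxE Normc.normc0 expr0n.
pose b i := \sum_(j < n) Normc.normc (M i j).
exists (Num.sqrt (\sum_(i < n) b i ^+ 2)) => _ [v /= hv <-].
apply: ler_wsqrtr; apply: ler_sum => i _.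
have hb : Normc.normc ((M *m v) i 0) <= b i.
  rewrite mxE /b.
  elim/big_ind2: _ => [|x1 y1 x2 y2 h1 h2|j _].
  - by rewrite Normc.normc0.
  - exact: (le_trans (le_normcD _ _) (lerD h1 h2)).
  - rewrite Normc.normcM ler_piMr //.
    apply: le_trans hv; rewrite /l2norm -[leLHS]ger0_norm // -sqrtr_sqr.
    apply: ler_wsqrtr; rewrite (bigD1 j) //= lerDl.
    by apply: sumr_ge0 => k _; apply: sqr_ge0.
by rewrite lerXn2r ?nnegrE // (le_trans _ hb).
Qed.

(* Main.v *)
(* A maximum principle replaces random perturbation.  For M with simple spectrum,
   the complex Laplacian of M |-> sum |lambda_i(M)|^2 over the matrix entries is
   the sum of the squared eigenvalue condition numbers |v_i|^2 |w_i|^2.  Write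
   M = A + r F with r = delta ||A||, and maximise
     sum |lambda_i|^2 + (1/N) log |discriminant| - c (m + th tr (m - F^* F)^-1)
   over F and m.  The discriminant term is pluriharmonic and forces the maximiser
   to have simple spectrum.  The last term is a smoothed ||F||^2, as in the barrier
   method of Batson, Spielman and Srivastava: with th = 1/(16 n) it varies by a
   constant between F = 0 and ||F|| = 1, while at a stationary m, where
   th tr (m - F^* F)^-2 <= 1, its Laplacian is only O(n).  Comparing Laplacians at
   the maximiser gives sum |v_i|^2 |w_i|^2 <= 15 n^2 (1 + 1/delta)^2. *)
Require Import Defs.
From mathcomp Require Import all_boot all_order all_algebra.
From mathcomp Require Import all_classical all_reals all_analysis.
From mathcomp Require Import complex spectral ring lra.
Import Order.TTheory GRing.Theory Num.Theory.
Import numFieldNormedType.Exports.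
Local Open Scope ring_scope.
Set Implicit Arguments.
Unset Strict Implicit.
Unset Printing Implicit Defensive.
Import Normc.
Local Open Scope complex_scope.
Local Open Scope sesquilinear_scope.

(** The squared Frobenius norm of [F] could serve as the penalty, but its Laplacian is n^2, and the
    same comparison would bound kappa_V by a multiple of n^2; lowering the Laplacian to order n is
    what brings the exponent down to 3/2. Since [m] is a variable of the maximisation and not a
    function of [F], it can be frozen while [F] moves, and no implicit differentiation occurs.
    Eigenvalues are not differentiated either: [F] follows a curve, corrected at order z^2, on which
    they are exactly affine in z. The correction is holomorphic up to O(z^3), so it disappears from
    the four-point sums that stand for the Laplacian. The discriminant adds nothing at second order,
    so one finite [N] is enough; it only has to be so large that the maximiser stays off the
    boundary of the constraint [soft_level <= 1], which guarantees that [F] has norm at most 1.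
    Finally, rescaled eigenvectors give kappa_V <= sum |v_i| |w_i|, and Cauchy-Schwarz turns this
    into kappa_V^2 <= n sum |v_i|^2 |w_i|^2. *)

(** * Moduli of complex numbers and norms of matrices *)

Lemma normcE_norm (R : realType) (z : R[i]) : `|z| = (normc z)%:C.
Proof. by []. Qed.

Lemma normc_ge0 (R : realType) (z : R[i]) : 0 <= normc z.
Proof. by case: z => a b; apply: sqrtr_ge0. Qed.

Lemma normc_conj (R : realType) (z : R[i]) : normc (Num.conj z) = normc z.
Proof. by case: z => a b; rewrite /= sqrrN. Qed.

Lemma normc_real (R : realType) (x : R) : normc x%:C = `|x|.
Proof. by rewrite /= expr0n addr0 sqrtr_sqr. Qed.

Lemma normc_sqr (R : realType) (z : R[i]) :
  (normc z ^+ 2)%:C = Num.conj z * z.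
Proof. by rewrite rmorphXn /= -normcE_norm normCKC. Qed.

Lemma normc_eq0 (R : realType) (z : R[i]) : (normc z == 0) = (z == 0).
Proof. by apply/eqP/eqP => [/eq0_normc//|->]; rewrite normc0. Qed.

Lemma normc_sum (R : realType) (I : Type) (r : seq I) (P : pred I)
    (f : I -> R[i]) :
  normc (\sum_(i <- r | P i) f i) <= \sum_(i <- r | P i) normc (f i).
Proof.
elim/big_ind2: _ => [|x1 y1 x2 y2 h1 h2|//]; first by rewrite normc0.
exact: (le_trans (le_normcD _ _) (lerD h1 h2)).
Qed.

Lemma Re_le_normc (R : realType) (z : R[i]) : `|complex.Re z| <= normc z.
Proof. by rewrite -lecR -normcE_norm normc_ge_Re. Qed.

(** The entrywise l1 norm: submultiplicative, invariant under the adjoint, and a bound for entries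
    and trace alike, which makes it the gauge for all error terms. *)
Definition enorm {R : realType} {p q : nat} (A : 'M[R[i]]_(p, q)) : R :=
  \sum_i \sum_j normc (A i j).

(** The squared Frobenius norm. On a column it is the squared Euclidean length, so operator norm
    bounds take the form [frob2 (M *m v) <= B * frob2 v], without suprema or square roots. *)
Definition frob2 {R : realType} {p q : nat} (A : 'M[R[i]]_(p, q)) : R :=
  \sum_i \sum_j normc (A i j) ^+ 2.

Section Norms.
Variable R : realType.
Implicit Types p q s : nat.

Lemma enorm_ge0 p q (A : 'M[R[i]]_(p, q)) : 0 <= enorm A.
Proof. by do 2!apply: sumr_ge0 => ? _; apply: normc_ge0. Qed.

Lemma normc_le_enorm p q (A : 'M[R[i]]_(p, q)) i j : normc (A i j) <= enorm A.
Proof.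
rewrite /enorm (bigD1 i) //= (bigD1 j) //= -addrA lerDl addr_ge0 //.
  by apply: sumr_ge0 => ? _; apply: normc_ge0.
by do 2!apply: sumr_ge0 => ? _; apply: normc_ge0.
Qed.

Lemma enorm_eq0 p q (A : 'M[R[i]]_(p, q)) : enorm A = 0 -> A = 0.
Proof.
move=> h; apply/matrixP => i j; rewrite mxE; apply/eqP; rewrite -normc_eq0.
by rewrite eq_le normc_ge0 -h normc_le_enorm.
Qed.

Lemma enormD p q (A B : 'M[R[i]]_(p, q)) : enorm (A + B) <= enorm A + enorm B.
Proof.
rewrite /enorm -big_split /=; apply: ler_sum => i _.
rewrite -big_split /=; apply: ler_sum => j _.
by rewrite mxE le_normcD.
Qed.

Lemma enormZ p q (z : R[i]) (A : 'M[R[i]]_(p, q)) :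
  enorm (z *: A) = normc z * enorm A.
Proof.
rewrite /enorm mulr_sumr; apply: eq_bigr => i _.
by rewrite mulr_sumr; apply: eq_bigr => j _; rewrite mxE normcM.
Qed.

Lemma enormN p q (A : 'M[R[i]]_(p, q)) : enorm (- A) = enorm A.
Proof. by rewrite -scaleN1r enormZ normcN normc1 mul1r. Qed.

Lemma enormM p q s (A : 'M[R[i]]_(p, q)) (B : 'M[R[i]]_(q, s)) :
  enorm (A *m B) <= enorm A * enorm B.
Proof.
rewrite /enorm mulr_suml; apply: ler_sum => i _.
rewrite mulr_suml.
have le1 : forall j, normc ((A *m B) i j) <= \sum_k normc (A i k) * normc (B k j).
  move=> j; rewrite mxE; apply: le_trans (normc_sum _ _ _) _.
  by apply: ler_sum => k _; rewrite normcM.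
apply: le_trans (ler_sum _ (fun j _ => le1 j)) _.
rewrite exchange_big /=; apply: ler_sum => k _; rewrite -mulr_sumr.
apply: ler_wpM2l; first exact: normc_ge0.
rewrite [leRHS](bigD1 k) //= lerDl.
by do 2!apply: sumr_ge0 => ? _; apply: normc_ge0.
Qed.

Lemma enorm_adj p q (A : 'M[R[i]]_(p, q)) : enorm (A^t*) = enorm A.
Proof.
rewrite /enorm exchange_big; apply: eq_bigr => i _; apply: eq_bigr => j _.
by rewrite !mxE normc_conj.
Qed.

Lemma normc_trace p (A : 'M[R[i]]_p) : normc (\tr A) <= enorm A.
Proof.
apply: le_trans (normc_sum _ _ _) _; apply: ler_sum => i _.
rewrite (bigD1 i) //= lerDl; apply: sumr_ge0 => ? _; exact: normc_ge0.
Qed.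

Lemma adjM p q s (A : 'M[R[i]]_(p, q)) (B : 'M[R[i]]_(q, s)) :
  (A *m B)^t* = B^t* *m A^t*.
Proof. by rewrite trmx_mul map_mxM. Qed.

Lemma adjD p q (A B : 'M[R[i]]_(p, q)) : (A + B)^t* = A^t* + B^t*.
Proof. by rewrite linearD /= map_mxD. Qed.

Lemma adjN p q (A : 'M[R[i]]_(p, q)) : (- A)^t* = - A^t*.
Proof. by rewrite linearN /= map_mxN. Qed.

Lemma adjZ p q z (A : 'M[R[i]]_(p, q)) : (z *: A)^t* = Num.conj z *: A^t*.
Proof. by rewrite linearZ /= map_mxZ. Qed.

Lemma adj_scalar p (x : R) : (x%:C%:M : 'M[R[i]]_p)^t* = x%:C%:M.
Proof. by rewrite tr_scalar_mx map_scalar_mx /=; congr (_%:M); apply: conjc_real. Qed.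

Lemma frob2_ge0 p q (A : 'M[R[i]]_(p, q)) : 0 <= frob2 A.
Proof. by do 2!apply: sumr_ge0 => ? _; apply: sqr_ge0. Qed.

Lemma frob2_tr p q (A : 'M[R[i]]_(p, q)) : (frob2 A)%:C = \tr (A^t* *m A).
Proof.
rewrite /frob2 /mxtrace exchange_big /= rmorph_sum; apply: eq_bigr => i _.
rewrite mxE rmorph_sum; apply: eq_bigr => j _.
by rewrite [LHS]normc_sqr !mxE.
Qed.

Lemma frob2_adj p q (A : 'M[R[i]]_(p, q)) : frob2 (A^t*) = frob2 A.
Proof.
rewrite /frob2 exchange_big; apply: eq_bigr => i _; apply: eq_bigr => j _.
by rewrite !mxE normc_conj.
Qed.

Lemma frob2_col p q (A : 'M[R[i]]_(p, q)) :
  frob2 A = \sum_j frob2 (col j A).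
Proof.
rewrite /frob2 exchange_big; apply: eq_bigr => j _; apply: eq_bigr => i _.
by rewrite big_ord1 mxE.
Qed.

Lemma frob2Z p q (z : R[i]) (A : 'M[R[i]]_(p, q)) :
  frob2 (z *: A) = normc z ^+ 2 * frob2 A.
Proof.
rewrite /frob2 mulr_sumr; apply: eq_bigr => i _.
by rewrite mulr_sumr; apply: eq_bigr => j _; rewrite mxE normcM exprMn.
Qed.

Lemma l2norm_frob2 p (v : 'cV[R[i]]_p) : l2norm v = Num.sqrt (frob2 v).
Proof. by congr Num.sqrt; apply: eq_bigr => i _; rewrite big_ord1. Qed.

Lemma l2norm_sqr p (v : 'cV[R[i]]_p) : l2norm v ^+ 2 = frob2 v.
Proof. by rewrite l2norm_frob2 sqr_sqrtr ?frob2_ge0. Qed.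

Lemma normc_le_frob2 p q (A : 'M[R[i]]_(p, q)) i j : normc (A i j) ^+ 2 <= frob2 A.
Proof.
rewrite /frob2 (bigD1 i) //= (bigD1 j) //= -addrA lerDl addr_ge0 //.
  by apply: sumr_ge0 => ? _; apply: sqr_ge0.
by do 2!apply: sumr_ge0 => ? _; apply: sqr_ge0.
Qed.

Lemma frob2_eq0 p q (A : 'M[R[i]]_(p, q)) : frob2 A = 0 -> A = 0.
Proof.
move=> h; apply/matrixP => i j; rewrite mxE; apply/eqP; rewrite -normc_eq0.
by rewrite -sqrf_eq0 eq_le sqr_ge0 -h normc_le_frob2.
Qed.

(** Lagrange's identity: the double sum of the squares of [a i * b j - a j * b i] is twice the
    difference of the two sides. *)
Lemma sum_cauchy_schwarz (I : finType) (a b : I -> R) :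
  (\sum_i a i * b i) ^+ 2 <= (\sum_i a i ^+ 2) * (\sum_i b i ^+ 2).
Proof.
have : 0 <= \sum_i \sum_j (a i * b j - a j * b i) ^+ 2.
  by do 2!apply: sumr_ge0 => ? _; apply: sqr_ge0.
have -> : \sum_i \sum_j (a i * b j - a j * b i) ^+ 2 =
  2 * ((\sum_i a i ^+ 2) * (\sum_i b i ^+ 2) - (\sum_i a i * b i) ^+ 2).
  have e : (\sum_i a i ^+ 2) * (\sum_i b i ^+ 2) =
      \sum_i \sum_j a j ^+ 2 * b i ^+ 2.
    by rewrite big_distrlr /= exchange_big.
  rewrite mulrBr mulr_natl mulr2n {1}e expr2 !big_distrlr /= mulr_sumr.
  rewrite -big_split -sumrB /=; apply: eq_bigr => i _.
  rewrite mulr_sumr -big_split -sumrB /=; apply: eq_bigr => j _.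
  by ring.
by rewrite pmulr_rge0 // subr_ge0.
Qed.

Lemma frob2M p q s (A : 'M[R[i]]_(p, q)) (B : 'M[R[i]]_(q, s)) :
  frob2 (A *m B) <= frob2 A * frob2 B.
Proof.
rewrite /frob2 mulr_suml; apply: ler_sum => i _.
rewrite [X in _ * X]exchange_big mulr_sumr; apply: ler_sum => j _.
apply: le_trans (sum_cauchy_schwarz _ _).
rewrite lerXn2r ?nnegrE ?normc_ge0 //.
  by apply: sumr_ge0 => k _; rewrite mulr_ge0 ?normc_ge0.
rewrite mxE; apply: le_trans (normc_sum _ _ _) _.
by apply: ler_sum => k _; rewrite normcM.
Qed.

End Norms.

(** * Asymptotics at zero *)

(** An explicit disc around 0: it is invariant under multiplication by i and -1, so a property near
    0 holds at once at [z], [iz], [-z] and [-iz]. *)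
Definition near0 {R : realType} (P : R[i] -> Prop) : Prop :=
  exists2 e : R, 0 < e & forall z, normc z < e -> P z.

Definition bigO {R : realType} (k : nat) {p q : nat}
    (g : R[i] -> 'M[R[i]]_(p, q)) : Prop :=
  exists2 K : R, 0 <= K & near0 (fun z => enorm (g z) <= K * normc z ^+ k).

Section BigO.
Variable R : realType.
Implicit Types (p q s k : nat) (P Q : R[i] -> Prop).

Lemma near0_and P Q : near0 P -> near0 Q -> near0 (fun z => P z /\ Q z).
Proof.
move=> [e e0 hP] [d d0 hQ]; exists (Num.min e d); first by rewrite lt_min e0.
by move=> z; rewrite lt_min => /andP[/hP ? /hQ ?].
Qed.

Lemma near0_imp P Q : (forall z, P z -> Q z) -> near0 P -> near0 Q.
Proof. by move=> h [e e0 hP]; exists e => // z /hP/h. Qed.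

Lemma near0_all P : (forall z, P z) -> near0 P.
Proof. by move=> h; exists 1. Qed.

Lemma near0_small (e : R) : 0 < e -> near0 (fun z => normc z < e).
Proof. by move=> e0; exists e. Qed.

Lemma bigO_near k p q (f g : R[i] -> 'M[R[i]]_(p, q)) :
  near0 (fun z => f z = g z) -> bigO k f -> bigO k g.
Proof.
move=> hfg [K K0 hf]; exists K => //.
by apply: near0_imp (near0_and hfg hf) => z [->].
Qed.

Lemma bigO_ext k p q (f g : R[i] -> 'M[R[i]]_(p, q)) :
  (forall z, f z = g z) -> bigO k f -> bigO k g.
Proof. by move=> h; apply: bigO_near; apply: near0_all. Qed.

Lemma bigO_const p q (A : 'M[R[i]]_(p, q)) : bigO 0 (fun=> A).
Proof.
exists (enorm A); first exact: enorm_ge0.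
by apply: near0_all => z; rewrite expr0 mulr1.
Qed.

Lemma bigOD k p q (f g : R[i] -> 'M[R[i]]_(p, q)) :
  bigO k f -> bigO k g -> bigO k (fun z => f z + g z).
Proof.
move=> [K K0 hf] [L L0 hg]; exists (K + L); first exact: addr_ge0.
apply: near0_imp (near0_and hf hg) => z [h1 h2].
by rewrite mulrDl; apply: le_trans (enormD _ _) (lerD h1 h2).
Qed.

Lemma bigON k p q (f : R[i] -> 'M[R[i]]_(p, q)) :
  bigO k f -> bigO k (fun z => - f z).
Proof. by move=> [K K0 hf]; exists K => //; apply: near0_imp hf => z; rewrite enormN. Qed.

Lemma bigOM k l p q s (f : R[i] -> 'M[R[i]]_(p, q)) (g : R[i] -> 'M[R[i]]_(q, s)) :
  bigO k f -> bigO l g -> bigO (k + l) (fun z => f z *m g z).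
Proof.
move=> [K K0 hf] [L L0 hg]; exists (K * L); first exact: mulr_ge0.
apply: near0_imp (near0_and hf hg) => z [h1 h2].
apply: le_trans (enormM _ _) _.
by rewrite exprD mulrACA ler_pM ?enorm_ge0.
Qed.

Lemma bigO_adj k p q (f : R[i] -> 'M[R[i]]_(p, q)) :
  bigO k f -> bigO k (fun z => (f z)^t*).
Proof. by move=> [K K0 hf]; exists K => //; apply: near0_imp hf => z; rewrite enorm_adj. Qed.

Lemma bigOZ k p q (f : R[i] -> 'M[R[i]]_(p, q)) :
  bigO k f -> bigO k.+1 (fun z => z *: f z).
Proof.
move=> [K K0 hf]; exists K => //; apply: near0_imp hf => z h.
by rewrite enormZ exprS mulrCA ler_wpM2l ?normc_ge0.
Qed.

Lemma bigOZconj k p q (f : R[i] -> 'M[R[i]]_(p, q)) :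
  bigO k f -> bigO k.+1 (fun z => Num.conj z *: f z).
Proof.
move=> [K K0 hf]; exists K => //; apply: near0_imp hf => z h.
by rewrite enormZ normc_conj exprS mulrCA ler_wpM2l ?normc_ge0.
Qed.

Lemma bigO_weaken k l p q (f : R[i] -> 'M[R[i]]_(p, q)) :
  (k <= l)%N -> bigO l f -> bigO k f.
Proof.
move=> kl [K K0 hf]; exists K => //.
apply: near0_imp (near0_and hf (near0_small ltr01)) => z [h1 h2].
apply: le_trans h1 _; apply: ler_wpM2l => //.
by apply: ler_wiXn2l => //; [exact: normc_ge0 | exact: ltW].
Qed.

Lemma bigO_enorm_small k p q (f : R[i] -> 'M[R[i]]_(p, q)) (e : R) :
  0 < e -> bigO k.+1 f -> near0 (fun z => enorm (f z) <= e).
Proof.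
move=> e0 /(bigO_weaken (ltn0Sn k)) [K K0 hf].
have d0 : 0 < e / (K + 1) by rewrite divr_gt0 // ltr_wpDl.
apply: near0_imp (near0_and hf (near0_small d0)) => z [h1 h2].
apply: le_trans h1 _; rewrite expr1.
apply: le_trans (_ : (K + 1) * normc z <= _).
  by rewrite ler_wpM2r ?normc_ge0 // lerDl.
by rewrite mulrC -ler_pdivlMr ?ltW // ltr_wpDl.
Qed.

(** A row vector killed by [1 - Y] satisfies [v = v Y], hence |v| <= |v| |Y|, which forces
    [v = 0]. *)
Lemma unitmx_small p (Y : 'M[R[i]]_p) : enorm Y < 1 -> 1%:M - Y \in unitmx.
Proof.
move=> hY; rewrite -row_free_unit -kermx_eq0; apply/rowV0P => v /sub_kermxP.
rewrite mulmxBr mulmx1 => /eqP; rewrite subr_eq0 => /eqP hv.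
apply: enorm_eq0; apply/eqP; rewrite eq_le enorm_ge0 andbT leNgt; apply/negP => h0.
have := enormM v Y; rewrite -hv -[X in X <= _]mulr1.
by rewrite ler_pM2l // leNgt hY.
Qed.

Lemma bigO_unit p (Y : R[i] -> 'M[R[i]]_p) :
  bigO 1 Y -> near0 (fun z => 1%:M - Y z \in unitmx).
Proof.
move=> hY; have h2 : (0 : R) < 1/2 by rewrite divr_gt0.
apply: near0_imp (bigO_enorm_small h2 hY) => z h.
by apply: unitmx_small; apply: le_lt_trans h _; lra.
Qed.

(** The inverse [B] satisfies [B = 1 + Y B]; once |Y| <= 1/2 this yields |B| <= 2 |1|. *)
Lemma bigO_inv p (Y : R[i] -> 'M[R[i]]_p) :
  bigO 1 Y -> bigO 0 (fun z => invmx (1%:M - Y z)).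
Proof.
move=> hY; exists (2 * enorm (1%:M : 'M[R[i]]_p)).
  by rewrite mulr_ge0 ?enorm_ge0.
have h2 : (0 : R) < 1/2 by rewrite divr_gt0.
apply: near0_imp (near0_and (bigO_unit hY) (bigO_enorm_small h2 hY)) => z [hu h].
rewrite expr0 mulr1; set B := invmx _.
have eB : B = 1%:M + Y z *m B.
  have : (1%:M - Y z) *m B = 1%:M by rewrite mulmxV.
  by rewrite mulmxBl mul1mx => <-; rewrite subrK.
have := enormD 1%:M (Y z *m B); rewrite -eB.
have := enormM (Y z) B; have := enorm_ge0 B; move: h; nra.
Qed.

End BigO.

(** * Neumann expansion of the inverse near an invertible matrix *)

Section Resolvent.
Variables (R : realType) (p : nat) (P Q : 'M[R[i]]_p) (D : R[i] -> 'M[R[i]]_p).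
Hypotheses (QP : Q *m P = 1%:M) (hD : bigO 1 D).

Let PQ : P *m Q = 1%:M. Proof. exact: mulmx1C. Qed.

Let hQD : bigO 1 (fun z => Q *m D z).
Proof. exact: (bigOM (bigO_const Q) hD). Qed.

Let sub_fact z : P - D z = P *m (1%:M - Q *m D z).
Proof. by rewrite mulmxBr mulmx1 mulmxA PQ mul1mx. Qed.

Lemma resolvent_unit : near0 (fun z => P - D z \in unitmx).
Proof.
apply: near0_imp (bigO_unit hQD) => z h; rewrite sub_fact unitmx_mul h andbT.
by have [] := mulmx1_unit PQ.
Qed.

Lemma resolvent_bounded : bigO 0 (fun z => invmx (P - D z)).
Proof.
apply: bigO_near (bigOM (bigO_inv hQD) (bigO_const Q)).
apply: near0_imp (near0_and (bigO_unit hQD) resolvent_unit) => z [h1 h2].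
apply: (can_inj (mulKmx h2)); rewrite mulmxV // sub_fact mulmxA.
by rewrite -(mulmxA P) mulmxV // mulmx1.
Qed.

(** The resolvent identity. Substituted into itself it produces the truncated Neumann series, with a
    remainder that still contains the bounded inverse. *)
Lemma resolvent_step z : P - D z \in unitmx ->
  invmx (P - D z) = Q + Q *m D z *m invmx (P - D z).
Proof.
move=> h; apply: (can_inj (mulmxK h)); rewrite mulmxDl mulVmx // -(mulmxA (Q *m _)).
by rewrite mulVmx // mulmx1 mulmxBr QP subrK.
Qed.

Lemma resolvent_first : bigO 1 (fun z => invmx (P - D z) - Q).
Proof.
apply: bigO_near (bigOM hQD resolvent_bounded).
apply: near0_imp resolvent_unit => z h.
by have e := resolvent_step h; rewrite [in RHS]e addrAC subrr add0r.
Qed.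

Lemma resolvent_second :
  bigO 3 (fun z => invmx (P - D z) - (Q + Q *m D z *m Q + Q *m D z *m Q *m D z *m Q)).
Proof.
apply: bigO_near (bigOM (bigOM (bigOM hQD hQD) hQD) resolvent_bounded).
apply: near0_imp resolvent_unit => z h.
have e := resolvent_step h; set I := invmx _ in e *.
rewrite [in RHS]e [in RHS]e [in RHS]e !mulmxDr !mulmxA !addrA.
by rewrite [RHS]addrAC subrr add0r.
Qed.

End Resolvent.

(* Summing over [z, iz, -z, -iz] keeps, up to third order, only the constant and
   [|z|^2] coefficients: a discrete complex Laplacian. *)
Definition four {R : realType} {V : zmodType} (f : R[i] -> V) (z : R[i]) : V :=
  f z + f ('i%R * z) + f (- z) + f (- ('i%R * z)).

Section FourPoints.
Variable R : realType.
Implicit Types z : R[i].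

Lemma fourD (V : zmodType) (f g : R[i] -> V) z :
  four (fun z => f z + g z) z = four f z + four g z.
Proof. by rewrite /four (addrACA (f z)) (addrACA (f z + _)) (addrACA (f z + _ + _)). Qed.

Lemma fourB (V : zmodType) (f g : R[i] -> V) z :
  four (fun z => f z - g z) z = four f z - four g z.
Proof. by rewrite fourD; congr (_ + _); rewrite /four !opprD. Qed.

Lemma four_const (V : zmodType) (x : V) z : four (fun=> x) z = x *+ 4.
Proof. by rewrite /four !mulrS mulr0n addr0 !addrA. Qed.

Lemma four_eq (V : zmodType) (f g : R[i] -> V) z :
  f =1 g -> four f z = four g z.
Proof. by move=> h; rewrite /four !h. Qed.

Lemma normc_i z : normc ('i%R * z) = normc z.
Proof. by rewrite normcM /= expr0n expr1n add0r sqrtr1 mul1r. Qed.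

Lemma sqr_iz z : ('i%R * z) ^+ 2 = - z ^+ 2.
Proof. by rewrite exprMn sqrCi mulN1r. Qed.

Lemma conj_iz z : Num.conj ('i%R * z) = - ('i%R * Num.conj z).
Proof. by rewrite rmorphM /= conjCi mulNr. Qed.

Lemma four_id z : four (fun z => z) z = 0.
Proof. by rewrite /four; ring. Qed.

Lemma four_conj z : four (fun z => Num.conj z) z = 0.
Proof. by rewrite /four !rmorphN; ring. Qed.

Lemma four_sqr z : four (fun z => z ^+ 2) z = 0.
Proof. by rewrite /four !sqrrN sqr_iz; ring. Qed.

Lemma four_conj_sqr z : four (fun z => Num.conj z ^+ 2) z = 0.
Proof.
rewrite /four !rmorphN /= !conj_iz !sqrrN sqr_iz; ring.
Qed.

Lemma four_conj_mul z :
  four (fun z => Num.conj z * z) z = (normc z ^+ 2)%:C *+ 4.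
Proof. by rewrite /four -!normc_sqr !normcN !normc_i !mulrS mulr0n addr0 !addrA. Qed.

Lemma four_scale (W : lmodType R[i]) (f : R[i] -> R[i]) (X : W) z :
  four (fun z => f z *: X) z = four f z *: X.
Proof. by rewrite /four !scalerDl. Qed.

Lemma bigO_four k p q (f : R[i] -> 'M[R[i]]_(p, q)) :
  bigO k f -> bigO k (fun z => four f z).
Proof.
move=> [K K0 [e e0 hf]]; exists (K *+ 4); first exact: mulrn_wge0.
exists e => // z hz.
have h w : normc w = normc z -> enorm (f w) <= K * normc z ^+ k.
  by move=> hw; rewrite -hw; apply: hf; rewrite hw.
have hN w : normc (- w) = normc w by rewrite normcN.
apply: le_trans (enormD _ _) _; rewrite mulrnAl mulrSr lerD //; last first.
  by apply: h; rewrite hN normc_i.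
apply: le_trans (enormD _ _) _; rewrite mulrSr lerD //; last by apply: h; rewrite hN.
apply: le_trans (enormD _ _) _; rewrite mulrSr mulr1n lerD //; first exact: h.
by apply: h; rewrite normc_i.
Qed.

End FourPoints.

(** * Second-order expansion of the barrier along a curve *)

Ltac mx_abelian :=
  repeat match goal with |- context [?A *m ?B] =>
    let X := fresh "X" in move: (A *m B) => X end;
  apply/matrixP => ? ?; rewrite !mxE; ring.

Lemma jet_expand (K : comNzRingType) p (Q a b c d e : 'M[K]_p) (x y : K) :
  let l := x *: a + y *: b in
  let s := x ^+ 2 *: c + y ^+ 2 *: d + (y * x) *: e in
  Q + Q *m (l + s) *m Q + Q *m l *m Q *m l *m Q =
  Q + x *: (Q *m a *m Q) + y *: (Q *m b *m Q)
  + x ^+ 2 *: (Q *m c *m Q + Q *m a *m Q *m a *m Q)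
  + y ^+ 2 *: (Q *m d *m Q + Q *m b *m Q *m b *m Q)
  + (y * x) *: (Q *m e *m Q + (Q *m a *m Q *m b *m Q + Q *m b *m Q *m a *m Q)).
Proof.
have h2 (s t : K) (X Y : 'M[K]_p) :
    Q *m (s *: X) *m Q *m (t *: Y) *m Q = (s * t) *: (Q *m X *m Q *m Y *m Q).
  by do ![rewrite -scalemxAr | rewrite -scalemxAl]; rewrite scalerA mulrC.
have h1 (s : K) (X : 'M[K]_p) : Q *m (s *: X) *m Q = s *: (Q *m X *m Q).
  by rewrite -scalemxAr -scalemxAl.
move=> l s; rewrite /l /s !(mulmxDr, mulmxDl) !h2 !h1 !scalerDr.
by mx_abelian.
Qed.

(* The [|z|^2] coefficient of [(m - F_z^* F_z)^-1] along [F_z = F + z H + O(z^2)],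
   where [Q] is its value at [z = 0]. *)
Definition barrier_hess {K : numClosedFieldType} {n : nat} (F H Q : 'M[K]_n) : 'M[K]_n :=
  Q *m (H^t* *m H) *m Q + (Q *m (F^t* *m H) *m Q *m (H^t* *m F) *m Q
    + Q *m (H^t* *m F) *m Q *m (F^t* *m H) *m Q).

Section Barrier.
Variables (R : realType) (n : nat) (m : R) (F H H2 Q : 'M[R[i]]_n).
Variable E3 : R[i] -> 'M[R[i]]_n.
Hypotheses (hE3 : bigO 3 E3) (QP : Q *m (m%:C%:M - F^t* *m F) = 1%:M).

Let Fz (z : R[i]) := F + z *: H + (z ^+ 2 *: H2 + E3 z).
Let D (z : R[i]) := (Fz z)^t* *m Fz z - F^t* *m F.
Let L (z : R[i]) := z *: (F^t* *m H) + Num.conj z *: (H^t* *m F).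
Let S (z : R[i]) := z ^+ 2 *: (F^t* *m H2) + Num.conj z ^+ 2 *: (H2^t* *m F)
  + (Num.conj z * z) *: (H^t* *m H).

Let bigO_a : bigO 1 (fun z => z *: H).
Proof. exact: bigOZ (bigO_const H). Qed.

Let bigO_b : bigO 2 (fun z => z ^+ 2 *: H2 + E3 z).
Proof.
apply: bigOD; last exact: bigO_weaken hE3.
apply: bigO_ext (bigOZ (bigOZ (bigO_const H2))) => z.
by rewrite scalerA expr2.
Qed.

Lemma gram_expansion : bigO 3 (fun z => D z - (L z + S z)).
Proof.
have cF := bigO_const F; have cF' := bigO_const (F^t*).
have ab := bigOM (bigO_adj bigO_a) bigO_b.
have ba := bigOM (bigO_adj bigO_b) bigO_a.
have bb := bigO_weaken (isT : (3 <= 4)%N) (bigOM (bigO_adj bigO_b) bigO_b).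
have Fe := bigOM cF' hE3; have eF := bigOM (bigO_adj hE3) cF.
apply: bigO_ext (bigOD (bigOD (bigOD (bigOD Fe eF) ab) ba) bb) => z.
have -> : L z + S z = F^t* *m (z *: H) + (z *: H)^t* *m F
    + (F^t* *m (z ^+ 2 *: H2) + (z ^+ 2 *: H2)^t* *m F + (z *: H)^t* *m (z *: H)).
  rewrite /L /S !adjZ -[_ *: H^t* *m _]scalemxAl -[in RHS]scalemxAr.
  by rewrite -[in RHS]scalemxAr -[_ *: H2^t* *m _]scalemxAl rmorphXn -scalemxAl -scalemxAr scalerA.
rewrite /D /Fz; move: (z *: H) (z ^+ 2 *: H2) (E3 z) => x y e.
rewrite !adjD !mulmxDl !mulmxDr.
by mx_abelian.
Qed.

Let bigO_L : bigO 1 L.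
Proof.
by apply: bigOD; [apply: bigOZ | apply: bigOZconj]; apply: bigO_const.
Qed.

Let bigO_S : bigO 2 S.
Proof.
apply: bigOD; first apply: bigOD.
- by apply: bigO_ext (bigOZ (bigOZ (bigO_const _))) => z; rewrite scalerA expr2.
- by apply: bigO_ext (bigOZconj (bigOZconj (bigO_const _))) => z; rewrite scalerA expr2.
- by apply: bigO_ext (bigOZconj (bigOZ (bigO_const _))) => z; rewrite scalerA.
Qed.

Let bigO_LD : bigO 2 (fun z => D z - L z).
Proof.
apply: bigO_ext (bigOD bigO_S (bigO_weaken _ gram_expansion)) => // z.
by move: (D z) (L z) (S z) => d l s; mx_abelian.
Qed.

Lemma gram_bigO1 : bigO 1 D.
Proof.
apply: bigO_ext (bigOD bigO_L (bigO_weaken _ bigO_LD)) => // z.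
by move: (D z) (L z) => d l; mx_abelian.
Qed.

Let J (z : R[i]) := Q + Q *m (L z + S z) *m Q + Q *m L z *m Q *m L z *m Q.

Let bigO_J : bigO 3 (fun z => invmx (m%:C%:M - F^t* *m F - D z) - J z).
Proof.
have hD := gram_bigO1; have cQ := bigO_const Q.
have t1 := bigOM (bigOM cQ gram_expansion) cQ.
have t2 := bigOM (bigOM (bigOM (bigOM cQ bigO_LD) cQ) hD) cQ.
have t3 := bigOM (bigOM (bigOM (bigOM cQ bigO_L) cQ) bigO_LD) cQ.
apply: bigO_ext (bigOD (bigOD (bigOD (resolvent_second QP hD) t1) t2) t3) => z.
rewrite /J; set I := invmx _; move: I (D z) (L z) (S z) => I d l s.
rewrite !(mulmxBr, mulmxDr, mulmxBl, mulmxDl, mulmxN, mulNmx).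
by mx_abelian.
Qed.

Lemma four_jet (V : lmodType R[i]) (A X1 X2 X3 X4 T : V) z :
  four (fun w => A + w *: X1 + Num.conj w *: X2 + w ^+ 2 *: X3
                 + Num.conj w ^+ 2 *: X4 + (Num.conj w * w) *: T) z
  = (A + (normc z ^+ 2)%:C *: T) *+ 4.
Proof.
rewrite !fourD four_const !four_scale four_id four_conj four_sqr four_conj_sqr.
by rewrite four_conj_mul !scale0r !addr0 mulrnDl scalerMnl.
Qed.

Let four_J z : four J z = (Q + (normc z ^+ 2)%:C *: barrier_hess F H Q) *+ 4.
Proof.
rewrite -(four_jet _ (Q *m (F^t* *m H) *m Q) (Q *m (H^t* *m F) *m Q)
  (Q *m (F^t* *m H2) *m Q + Q *m (F^t* *m H) *m Q *m (F^t* *m H) *m Q)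
  (Q *m (H2^t* *m F) *m Q + Q *m (H^t* *m F) *m Q *m (H^t* *m F) *m Q)).
by apply: four_eq => w; apply: jet_expand.
Qed.

Lemma barrier_expansion :
  bigO 3 (fun z => four (fun w => invmx (m%:C%:M - (Fz w)^t* *m Fz w)) z
                   - (Q + (normc z ^+ 2)%:C *: barrier_hess F H Q) *+ 4).
Proof.
apply: bigO_ext (bigO_four bigO_J) => z; rewrite fourB four_J; congr (_ - _).
by apply: four_eq => w; rewrite /D opprB addrA subrK.
Qed.

End Barrier.

(** * Positivity of m - F^* F and of its inverse *)

Lemma tr_quadDZ (K : numClosedFieldType) p s (M : 'M[K]_p) (v w : 'M[K]_(p, s)) (x : K) :
  \tr ((x *: v + w)^t* *m M *m (x *: v + w)) =
  Num.conj x * x * \tr (v^t* *m M *m v) + Num.conj x * \tr (v^t* *m M *m w)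
  + x * \tr (w^t* *m M *m v) + \tr (w^t* *m M *m w).
Proof.
have -> : (x *: v + w)^t* = Num.conj x *: v^t* + w^t*.
  by rewrite linearD linearZ /= map_mxD map_mxZ.
rewrite !mulmxDl !mulmxDr -!scalemxAl -!scalemxAr.
by rewrite !mxtraceD !mxtraceZ mulrA !addrA.
Qed.

Lemma conjC_real (R : realType) (x : R) : Num.conj x%:C = x%:C.
Proof. exact: conjc_real. Qed.

(* The operator norm of [F] is at most the square root of [m]. *)
Definition sq_contr {R : realType} {n : nat} (m : R) (F : 'M[R[i]]_n) : Prop :=
  forall v : 'cV[R[i]]_n, frob2 (F *m v) <= m * frob2 v.

Lemma frob2_le_enorm (R : realType) p q (A : 'M[R[i]]_(p, q)) :
  frob2 A <= enorm A ^+ 2.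
Proof.
rewrite expr2 {1}/enorm mulr_suml; apply: ler_sum => i _.
rewrite mulr_suml; apply: ler_sum => j _; rewrite expr2.
by rewrite ler_wpM2l ?normc_ge0 // normc_le_enorm.
Qed.

Lemma quad_form_bound (R : realType) p (D : 'M[R[i]]_p) (v : 'cV[R[i]]_p) :
  normc (\tr (v^t* *m D *m v)) <= enorm D * frob2 v.
Proof.
rewrite /mxtrace big_ord1.
rewrite -(@ler_pXn2r _ 2) ?nnegrE ?normc_ge0 ?mulr_ge0 ?enorm_ge0 ?frob2_ge0 //.
apply: le_trans (normc_le_frob2 _ _ _) _.
rewrite exprMn; apply: le_trans (frob2M _ _) _.
have := frob2M (v^t*) D; have := frob2_le_enorm D.
rewrite frob2_adj; have := frob2_ge0 v; have := frob2_ge0 D.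
have := frob2_ge0 (v^t* *m D); nra.
Qed.

Section Feasible.
Variables (R : realType) (n : nat) (m : R) (F Q : 'M[R[i]]_n).
Let P := m%:C%:M - F^t* *m F.
Hypotheses (QP : Q *m P = 1%:M) (contrF : sq_contr m F).
Let t := complex.Re (\tr Q).

Let PQ : P *m Q = 1%:M. Proof. exact: mulmx1C. Qed.

Lemma sq_contr_mx p (V : 'M[R[i]]_(n, p)) : frob2 (F *m V) <= m * frob2 V.
Proof.
rewrite frob2_col (frob2_col V) mulr_sumr; apply: ler_sum => j _.
by rewrite colE -mulmxA -colE; apply: contrF.
Qed.

Lemma quad_formE p (V : 'M[R[i]]_(n, p)) :
  \tr (V^t* *m P *m V) = (m * frob2 V - frob2 (F *m V))%:C.
Proof.
rewrite /P mulmxBr mulmxBl mul_mx_scalar -scalemxAl linearB linearZ /=.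
by rewrite rmorphB rmorphM /= !frob2_tr adjM !mulmxA.
Qed.

Let P_adj : P^t* = P.
Proof. by rewrite /P adjD adjN adj_scalar adjM trmxCK. Qed.

Lemma resolvent_adj : Q^t* = Q.
Proof.
have h : Q^t* *m P = 1%:M.
  by rewrite -{1}P_adj -adjM PQ trmx1 map_mx1.
by rewrite -[LHS]mulmx1 -PQ mulmxA h mul1mx.
Qed.

Let trQ : \tr Q = (m * frob2 Q - frob2 (F *m Q))%:C.
Proof. by rewrite -quad_formE resolvent_adj QP mul1mx. Qed.

Lemma resolvent_trE : \tr Q = t%:C.
Proof. by rewrite /t trQ. Qed.

Lemma resolvent_tr_ge0 : 0 <= t.
Proof. by rewrite /t trQ /= subr_ge0 sq_contr_mx. Qed.

Lemma resolvent_tr_sqr : t ^+ 2 <= n%:R * frob2 Q.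
Proof.
have -> : t = \sum_i complex.Re (Q i i) * 1.
  by rewrite /t /mxtrace raddf_sum /=; apply: eq_bigr => i _; rewrite mulr1.
apply: le_trans (sum_cauchy_schwarz _ _) _; rewrite mulrC.
rewrite (eq_bigr (fun=> 1)) => [|i _]; last by rewrite expr1n.
rewrite sumr_const card_ord; apply: ler_wpM2l => //.
apply: ler_sum => i _; rewrite (bigD1 i) //= -[leLHS]addr0 lerD //; last first.
  by apply: sumr_ge0 => j _; rewrite sqr_ge0.
by rewrite -real_normK ?num_real // lerXn2r ?nnegrE ?normc_ge0 // Re_le_normc.
Qed.

(** Since [Q = Q P Q], the quadratic form of [Q] at [V] is that of [P] at [Q V], which is
    nonnegative by the contraction hypothesis. *)
Lemma resolvent_quad_ge0 p (V : 'M[R[i]]_(n, p)) :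
  0 <= complex.Re (\tr (V^t* *m Q *m V)).
Proof.
have -> : V^t* *m Q *m V = (Q *m V)^t* *m P *m (Q *m V).
  by rewrite adjM resolvent_adj !mulmxA -(mulmxA _ Q P) QP mulmx1.
by rewrite quad_formE /= subr_ge0 sq_contr_mx.
Qed.

Let trQ_delta i j :
  \tr (delta_mx (0 : 'I_1) i *m Q *m delta_mx j 0) = Q i j.
Proof. by rewrite -rowE -colE /mxtrace big_ord1 !mxE. Qed.

Let Qii_le i : complex.Re (Q i i) <= t.
Proof.
rewrite /t /mxtrace raddf_sum /= (bigD1 i) //= lerDl; apply: sumr_ge0 => j _.
have := resolvent_quad_ge0 (delta_mx j (0 : 'I_1)).
by rewrite trmx_delta map_delta_mx trQ_delta.
Qed.

(** For a positive semidefinite matrix, 2 |Q i j| <= Q i i + Q j j. This bounds the inverse on the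
    feasible set, one half of its compactness. *)
Lemma resolvent_entry_le i j : normc (Q i j) <= t.
Proof.
have Qji : Q j i = Num.conj (Q i j).
  by rewrite -{1}resolvent_adj !mxE.
(* a phase x turning the cross terms of the quadratic form into -2|Q i j| *)
have [x nx hx] : exists2 x : R[i], Num.conj x * x = 1 & Num.conj x * Q i j = - (normc (Q i j))%:C.
  have [q0|q0] := eqVneq (Q i j) 0.
    by exists 1; rewrite ?rmorph1 ?mulr1 // q0 mulr0 normc0 oppr0.
  have nq0 : (normc (Q i j))%:C != 0 :> R[i].
    by rewrite (inj_eq (@complexI _)) normc_eq0.
  exists (- (Q i j / (normc (Q i j))%:C)).
    rewrite rmorphN rmorphM fmorphV /= mulrNN mulrACA -normc_sqr rmorphXn /=.
    by rewrite conjC_real -invfM -expr2 mulfV // expf_neq0.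
  rewrite rmorphN rmorphM fmorphV /= mulNr mulrAC -normc_sqr rmorphXn /=.
  by rewrite conjC_real expr2 mulfK.
have := resolvent_quad_ge0 (x *: delta_mx i (0 : 'I_1) + delta_mx j 0).
rewrite tr_quadDZ !trmx_delta !map_delta_mx !trQ_delta Qji.
have -> : x * Num.conj (Q i j) = - (normc (Q i j))%:C.
  rewrite -[x]conjCK -rmorphM hx rmorphN /=; by rewrite conjC_real.
rewrite nx mul1r hx !raddfD /=.
by have := Qii_le i; have := Qii_le j; lra.
Qed.

Hypothesis m1 : m <= 1.

Lemma resolvent_coercive (v : 'cV[R[i]]_n) :
  frob2 (P *m v) <= m * frob2 v - frob2 (F *m v).
Proof.
(* [P^2 <= P] because [0 <= P <= 1]; positivity is tested at [v - P v]. *)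
set w := P *m v.
have Pw : \tr (v^t* *m P *m w) = (frob2 w)%:C.
  by rewrite frob2_tr /w adjM P_adj.
have wP : \tr (w^t* *m P *m v) = (frob2 w)%:C by rewrite frob2_tr -mulmxA.
have := sq_contr_mx (-1 *: w + v); rewrite -subr_ge0.
have -> : m * frob2 (-1 *: w + v) - frob2 (F *m (-1 *: w + v)) =
   (m * frob2 w - frob2 (F *m w)) - frob2 w - frob2 w + (m * frob2 v - frob2 (F *m v)).
  apply: (@complexI R); rewrite -quad_formE tr_quadDZ Pw wP !quad_formE.
  by rewrite rmorphN1 mulrNN !mul1r !mulN1r !(rmorphB, rmorphD).
have := frob2_ge0 (F *m w); have := frob2_ge0 w; move: m1; nra.
Qed.

(** Nonnegativity of [P] survives small perturbations because [P] is invertible: coercivity gives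
    v^* P v >= |P v|^2 >= |v|^2 / |Q|^2, which absorbs [D]. *)
Lemma sq_contr_perturb (F' : R[i] -> 'M[R[i]]_n) :
  bigO 1 (fun z => (F' z)^t* *m F' z - F^t* *m F) -> near0 (fun z => sq_contr m (F' z)).
Proof.
move=> hD.
have e0 : 0 < (frob2 Q + 1)^-1 by rewrite invr_gt0 ltr_wpDl ?frob2_ge0.
apply: near0_imp (bigO_enorm_small e0 hD) => z; set D := _ - _ => hz v.
have hP := resolvent_coercive v.
have hv : frob2 v <= frob2 Q * frob2 (P *m v).
  by rewrite -{1}[v]mul1mx -QP -mulmxA frob2M.
have hd := le_trans (Re_le_normc _) (quad_form_bound D v).
have eD : complex.Re (\tr (v^t* *m D *m v)) = frob2 (F' z *m v) - frob2 (F *m v).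
  rewrite /D mulmxBr mulmxBl linearB /= -[frob2 (F' z *m v)]/(complex.Re (_ %:C)).
  rewrite -[frob2 (F *m v)]/(complex.Re (_ %:C)) !frob2_tr !adjM !mulmxA.
  by rewrite raddfB.
have h1 : enorm D * frob2 v <= frob2 (P *m v).
  have hz' : enorm D * (frob2 Q + 1) <= 1.
    by rewrite -ler_pdivlMr ?ltr_wpDl ?frob2_ge0 // div1r.
  have := frob2_ge0 (P *m v); have := enorm_ge0 D; have := frob2_ge0 Q; move: hv hz'.
  nra.
move: hd; rewrite eD ler_norml => /andP[_ h2]; lra.
Qed.

End Feasible.

(** * The barrier Hessian summed over matrix units *)

(** Each summand is [Y k k *: delta_mx j j]; the sum over [k] makes the trace and the sum over [j]
    the identity. In this way summing over all directions turns quadratic expressions into products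
    of traces. *)
Lemma sum_delta_conj (K : comNzRingType) n (Y : 'M[K]_n) :
  \sum_j \sum_k delta_mx j k *m Y *m delta_mx k j = (\tr Y)%:M :> 'M[K]_n.
Proof.
have h j k : delta_mx j k *m Y *m delta_mx k j = Y k k *: delta_mx j j :> 'M[K]_n.
  rewrite -(mul_delta_mx (0 : 'I_1) j k) -(mul_delta_mx (0 : 'I_1) k j).
  have e : delta_mx 0 k *m Y *m delta_mx k 0 = (Y k k)%:M :> 'M[K]_1.
    by rewrite -rowE -colE; apply/matrixP => a b; rewrite !mxE !ord1 eqxx mulr1n.
  rewrite -[RHS](_ : delta_mx j (0 : 'I_1) *m (Y k k)%:M *m delta_mx 0 j = _).
    by rewrite -e !mulmxA.
  by rewrite mul_mx_scalar -scalemxAl mul_delta_mx.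
apply/matrixP => a b; rewrite summxE.
rewrite (eq_bigr (fun j => \tr Y * ((a == j) && (b == j))%:R)); last first.
  move=> j _; rewrite summxE mulr_suml; apply: eq_bigr => k _.
  by rewrite h !mxE.
rewrite -mulr_sumr mxE (bigD1 a) //= eqxx big1 ?addr0.
  by rewrite eq_sym mulr_natr.
by move=> j; rewrite eq_sym => /negbTE ->.
Qed.

Lemma sum_tr_delta (K : comNzRingType) n (A B Y : 'M[K]_n) :
  \sum_j \sum_k \tr (A *m (delta_mx j k *m Y *m delta_mx k j) *m B)
  = \tr Y * \tr (A *m B).
Proof.
have -> : \tr Y * \tr (A *m B) = \tr (A *m (\tr Y)%:M *m B).
  by rewrite mul_mx_scalar -scalemxAl mxtraceZ.
rewrite -sum_delta_conj mulmx_sumr mulmx_suml raddf_sum; apply: eq_bigr => j _.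
by rewrite mulmx_sumr mulmx_suml raddf_sum.
Qed.

(** The three terms of the Hessian sum to n tr Q^2, tr Q tr (Q F^* F Q) and tr (Q F^* F) tr Q^2.
    Substituting Q F^* F = m Q - 1 cancels the contributions of n. *)
Lemma barrier_hess_sum (K : numClosedFieldType) (n : nat) (m : K) (F Q : 'M[K]_n) :
  Q *m (m%:M - F^t* *m F) = 1%:M ->
  \sum_j \sum_k \tr (barrier_hess F (delta_mx j k) Q) =
  2 * m * \tr Q * \tr (Q *m Q) - \tr Q ^+ 2.
Proof.
move=> QP.
have QG : Q *m (F^t* *m F) = m *: Q - 1%:M.
  by rewrite -QP mulmxBr mul_mx_scalar opprB addrC subrK.
pose f1 (j k : 'I_n) := \tr (Q *m (delta_mx k j *m 1%:M *m delta_mx j k) *m Q).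
pose f2 (j k : 'I_n) := \tr (Q *m F^t* *m (delta_mx j k *m Q *m delta_mx k j) *m (F *m Q)).
pose f3 (j k : 'I_n) := \tr (Q *m (delta_mx k j *m (F *m Q *m F^t*) *m delta_mx j k) *m Q).
have add3 (a b c a' b' c' : K) :
    a = a' -> b = b' -> c = c' -> a + (b + c) = a' + b' + c'.
  by move=> -> -> ->; rewrite addrA.
have h j k : \tr (barrier_hess F (delta_mx j k) Q) = f1 j k + f2 j k + f3 j k.
  rewrite /barrier_hess 2!mxtraceD trmx_delta map_delta_mx.
  apply: add3.
  - by rewrite /f1 mulmx1.
  - rewrite /f2; congr (\tr _).
    by rewrite -!mulmxA.
  - rewrite /f3; congr (\tr _).
    by rewrite -!mulmxA.
rewrite (eq_bigr (fun j => \sum_k f1 j k + \sum_k f2 j k + \sum_k f3 j k)); last first.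
  by move=> j _; rewrite -!big_split; apply: eq_bigr => k _; apply: h.
rewrite !big_split /=.
have -> : \sum_j \sum_k f1 j k = n%:R * \tr (Q *m Q).
  by rewrite exchange_big [LHS]sum_tr_delta mxtrace1.
have -> : \sum_j \sum_k f2 j k = \tr Q * \tr (Q *m (F^t* *m F) *m Q).
  by rewrite [LHS]sum_tr_delta !mulmxA.
have -> : \sum_j \sum_k f3 j k = \tr (Q *m (F^t* *m F)) * \tr (Q *m Q).
  by rewrite exchange_big [LHS]sum_tr_delta; congr (_ * _); rewrite -mulmxA mxtrace_mulC mulmxA mxtrace_mulC mulmxA.
rewrite QG mulmxBl mul1mx -scalemxAl !linearB /= !mxtraceZ mxtrace1.
by ring.
Qed.

(** * Moving the eigenvalues along lines *)

(** Lists the eigenvalues with multiplicity. Being an identity for each [x], it passes to limits,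
    and it makes sense for matrices that are not diagonalizable. *)
Definition spectrum {K : fieldType} {n : nat} (M : 'M[K]_n) (l : 'I_n -> K) : Prop :=
  forall x, \det (x%:M - M) = \prod_i (x - l i).

Definition diagf {K : fieldType} {n : nat} (l : 'I_n -> K) : 'M[K]_n :=
  diag_mx (\row_i l i).

Lemma det_similar (K : fieldType) n (T S X : 'M[K]_n) x :
  T *m S = 1%:M -> \det (x%:M - T *m X *m S) = \det (x%:M - X).
Proof.
move=> TS; have -> : x%:M - T *m X *m S = T *m (x%:M - X) *m S.
  by rewrite mulmxBr mulmxBl mul_mx_scalar -scalemxAl TS scalemx1.
by rewrite !det_mulmx mulrAC -det_mulmx TS det1 mul1r.
Qed.

Lemma spectrum_diagf (K : fieldType) n (T S : 'M[K]_n) (l : 'I_n -> K) :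
  T *m S = 1%:M -> spectrum (T *m diagf l *m S) l.
Proof.
move=> TS x; rewrite det_similar //.
have -> : x%:M - diagf l = diag_mx (\row_i (x - l i)).
  apply/matrixP => i j; rewrite !mxE; case: eqVneq => [->|]; first by rewrite !mulr1n.
  by rewrite !mulr0n subrr.
by rewrite det_diag; apply: eq_bigr => i _; rewrite mxE.
Qed.

(* Conjugating by [1 + z X] moves the eigenvalues along exact lines; [X] solves the
   commutator equation that makes the first-order term equal to [h]. *)
Lemma commutator_eq (K : fieldType) n (l : 'I_n -> K) (h : 'M[K]_n) :
  injective l ->
  exists X : 'M[K]_n, X *m diagf l + diagf (fun i => h i i) = h + diagf l *m X.
Proof.
move=> linj; exists (\matrix_(i, j) (if i == j then 0 else h i j / (l j - l i))).
apply/matrixP => i j; rewrite /diagf mul_mx_diag mul_diag_mx !mxE.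
have [->|ij] := eqVneq i j; first by rewrite mul0r mulr0 mulr1n add0r addr0.
have d0 : l j - l i != 0 by rewrite subr_eq0; apply: contra_neq ij => /linj.
by rewrite mulr0n addr0; field.
Qed.

(** By the equation for [X], the product (1 + z X) (L + z B) is exactly (L + z h) (1 + z X) plus z^2
    (X B - h X). Writing [U1] = 1 - z X U1 then splits off the cubic remainder. *)
Lemma conj_expand (K : fieldType) n (L B h X U1 : 'M[K]_n) (z : K) :
  X *m L + B = h + L *m X -> (1%:M + z *: X) *m U1 = 1%:M ->
  (1%:M + z *: X) *m (L + z *: B) *m U1 =
  L + z *: h + (z ^+ 2 *: (X *m B - h *m X)
    + - (z *: (z *: (z *: ((X *m B - h *m X) *m X *m U1))))).
Proof.
move=> hX hU; set G := X *m B - h *m X.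
have -> : (1%:M + z *: X) *m (L + z *: B) = (L + z *: h) *m (1%:M + z *: X) + z ^+ 2 *: G.
  have XL : X *m L = h + L *m X - B by rewrite -hX addrK.
  rewrite /G !(mulmxDl, mulmxDr) !mul1mx !mulmx1 -!scalemxAl -!scalemxAr XL.
  by mx_abelian.
have eU : U1 = 1%:M - z *: (X *m U1).
  by rewrite -[in LHS](addrK (z *: (X *m U1)) U1) -[in RHS]hU mulmxDl mul1mx -scalemxAl addrK.
rewrite mulmxDl -mulmxA hU mulmx1; congr (_ + _).
rewrite -[LHS]scalemxAl {1}eU mulmxBr mulmx1 -scalemxAr mulmxA.
by mx_abelian.
Qed.

Section EigenCurve.
Variables (R : realType) (n : nat) (V W H : 'M[R[i]]_n) (l : 'I_n -> R[i]).
Hypotheses (WV : W *m V = 1%:M) (linj : injective l).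

Let h := W *m H *m V.

(** The direction [H] fixes the curve to first order only. Conjugation adds z^2 [N2] with a constant
    [N2], a holomorphic term that the four-point sums do not see, and a cubic error. The slope
    [h i i] is the classical first-order perturbation of a simple eigenvalue. *)
Lemma eigen_curve : exists N2 E3, [/\ bigO 3 E3
  & near0 (fun z => spectrum
      (V *m diagf l *m W + z *: H + (z ^+ 2 *: N2 + E3 z))
      (fun i => l i + z * h i i))].
Proof.
have VW := mulmx1C WV.
have [X hX] := commutator_eq h linj; pose B := diagf (fun i => h i i).
pose G := X *m B - h *m X.
pose U1 z := invmx (1%:M - z *: - X).
have hY : bigO 1 (fun z => z *: - X) by apply: bigOZ; apply: bigO_const.
have hU1 : bigO 0 U1 := bigO_inv hY.
exists (V *m G *m W), (fun z => V *m (- (z *: (z *: (z *: (G *m X *m U1 z))))) *m W).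
split.
  have h3 := bigON (bigOZ (bigOZ (bigOZ (bigOM (bigO_const (G *m X)) hU1)))).
  exact: bigOM (bigOM (bigO_const V) h3) (bigO_const W).
apply: near0_imp (bigO_unit hY) => z hu.
have hU : (1%:M + z *: X) *m U1 z = 1%:M.
  by rewrite -[X]opprK scalerN mulmxV.
have e : diagf (fun i => l i + z * h i i) = diagf l + z *: B.
  apply/matrixP => i j; rewrite !mxE; case: eqVneq => _; first by rewrite !mulr1n.
  by rewrite !mulr0n mulr0 addr0.
have TS : V *m (1%:M + z *: X) *m (U1 z *m W) = 1%:M.
  by rewrite -mulmxA (mulmxA _ (U1 z)) hU mul1mx.
have := spectrum_diagf (fun i => l i + z * h i i) TS.
rewrite e.
have -> : V *m (1%:M + z *: X) *m (diagf l + z *: B) *m (U1 z *m W) =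
    V *m ((1%:M + z *: X) *m (diagf l + z *: B) *m U1 z) *m W by rewrite !mulmxA.
rewrite (conj_expand hX hU) -/G.
rewrite [V *m (_ + _)]mulmxDr mulmxDl [V *m (_ + _)]mulmxDr mulmxDl.
have -> : V *m (z *: h) *m W = z *: H.
  by rewrite -scalemxAr -scalemxAl /h !mulmxA VW mul1mx -mulmxA VW mulmx1.
by rewrite [V *m (_ + _)]mulmxDr mulmxDl -[V *m (z ^+ 2 *: G)]scalemxAr -[_ *: (V *m G) *m W]scalemxAl.
Qed.

End EigenCurve.

(** The rows of [W] are left eigenvectors, independent because eigenspaces of distinct eigenvalues
    form a direct sum. *)
Lemma spectrum_diagonalization (K : fieldType) n (M : 'M[K]_n) (l : 'I_n -> K) :
  spectrum M l -> injective l ->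
  exists2 W : 'M[K]_n, W \in unitmx & M = invmx W *m diagf l *m W.
Proof.
move=> hs linj.
have hv i : exists v : 'rV[K]_n, v != 0 /\ v *m M = l i *: v.
  have /eqP/det0P [v v0 hv] : \det ((l i)%:M - M) = 0.
    by rewrite hs (bigD1 i) //= subrr mul0r.
  exists v; split=> //; move/eqP: hv.
  by rewrite mulmxBr mul_mx_scalar subr_eq0 => /eqP.
have [v hvM] := choice hv; pose W := \matrix_i v i.
have v0 i : v i != 0 by have [] := hvM i.
have vM i : v i *m M = l i *: v i by have [] := hvM i.
have WM : W *m M = diagf l *m W.
  apply/row_matrixP => i; rewrite row_mul rowK vM.
  by apply/rowP => j; rewrite /diagf mul_diag_mx !mxE.
have uW : W \in unitmx.
  rewrite -row_free_unit -kermx_eq0; apply/rowV0P => u /sub_kermxP.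
  rewrite mulmx_sum_row => hu; apply/rowP => i; rewrite [RHS]mxE.
  have /mxdirect_sumsP/(_ i isT) hd :=
    @mxdirect_sum_eigenspace _ _ _ M xpredT l (in2W linj).
  have hi : (u 0 i *: v i <= eigenspace M (l i) :&: \sum_(j | j != i) eigenspace M (l j))%MS.
    rewrite sub_capmx; apply/andP; split.
      by apply/eigenspaceP; rewrite -scalemxAl vM !scalerA mulrC.
    have -> : u 0 i *: v i = - \sum_(j | j != i) u 0 j *: v j.
      apply/eqP; rewrite -addr_eq0; apply/eqP.
      move: hu; rewrite (bigD1 i) //= rowK => hu; apply: etrans hu; congr (_ + _).
      by apply: eq_bigr => j _; rewrite rowK.
    rewrite eqmx_opp; apply: summx_sub_sums => j _.
    by apply/eigenspaceP; rewrite -scalemxAl vM !scalerA mulrC.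
  move: hi; rewrite hd submx0 scaler_eq0 (negbTE (v0 i)) orbF => /eqP //.
exists W => //.
by rewrite -mulmxA -WM mulKmx.
Qed.

(** * Existence of a maximiser *)

Definition cvgC {R : realType} (U : set_system nat) (z : nat -> R[i]) (w : R[i]) : Prop :=
  (complex.Re (z k) @[k --> U] --> complex.Re w)%classic /\
  (complex.Im (z k) @[k --> U] --> complex.Im w)%classic.

Definition cvgmx {R : realType} (U : set_system nat) {p q : nat}
    (A : nat -> 'M[R[i]]_(p, q)) (B : 'M[R[i]]_(p, q)) : Prop :=
  forall i j, cvgC U (fun k => A k i j) (B i j).

(* Limits along an ultrafilter avoid the extraction of subsequences. *)
Section UltraLimits.
Variables (R : realType) (U : set_system nat).
Context {FU : UltraFilter U}.
Implicit Types (u : nat -> R) (z : nat -> R[i]) (w : R[i]) (x : R).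

(** Compactness of the segment provides a cluster point. It is a limit, because an ultrafilter
    contains either the preimage of a neighbourhood or its complement. *)
Lemma ultra_bounded_cvg u b :
  (forall k, `|u k| <= b) -> exists x : R, (u k @[k --> U] --> x)%classic.
Proof.
move=> hb.
have hF : (u k @[k --> U])%classic `[(- b), b]%classic.
  by apply: nearW => k /=; rewrite in_itv /= -ler_norml.
have [x [_ hx]] := @segment_compact R (- b) b _ _ hF.
exists x => V hV /=.
have [//|hC] := in_ultra_setVsetC (u @^-1` V)%classic FU.
have [y [/= h1 h2]] := hx (~` V)%classic V hC hV.
by [].
Qed.

Lemma ultra_bounded_cvgC z b :
  (forall k, normc (z k) <= b) -> exists w : R[i], cvgC U z w.
Proof.
move=> hb.
have [x hx] := ultra_bounded_cvg (fun k => le_trans (Re_le_normc (z k)) (hb k)).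
have hI k : `|complex.Im (z k)| <= b.
  apply: le_trans (hb k); have := Re_le_normc (z k * 'i%C).
  by rewrite ReiNIm normrN mulrC normc_i.
have [y hy] := ultra_bounded_cvg hI.
by exists (x +i* y).
Qed.

Lemma cvgC_cst w : @cvgC R U (fun=> w) w.
Proof. by split; apply: cvg_cst. Qed.

Lemma cvgC_real u x : (u k @[k --> U] --> x)%classic -> cvgC U (fun k => (u k)%:C) x%:C.
Proof. by move=> h; split => //=; apply: cvg_cst. Qed.

Lemma cvgCD z1 z2 w1 w2 :
  @cvgC R U z1 w1 -> cvgC U z2 w2 -> cvgC U (fun k => z1 k + z2 k) (w1 + w2).
Proof.
move=> [r1 i1] [r2 i2]; split; rewrite raddfD.
  by under eq_fun do rewrite raddfD; apply: cvgD.
by under eq_fun do rewrite raddfD; apply: cvgD.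
Qed.

Lemma cvgCM z1 z2 w1 w2 :
  @cvgC R U z1 w1 -> cvgC U z2 w2 -> cvgC U (fun k => z1 k * z2 k) (w1 * w2).
Proof.
have reM (x y : R[i]) : complex.Re (x * y) = complex.Re x * complex.Re y - complex.Im x * complex.Im y.
  by case: x y => ? ? [].
have imM (x y : R[i]) : complex.Im (x * y) = complex.Re x * complex.Im y + complex.Im x * complex.Re y.
  by case: x y => ? ? [].
move=> [r1 i1] [r2 i2]; split; rewrite ?reM ?imM.
  by under eq_fun do rewrite reM; apply: cvgB; apply: cvgM.
by under eq_fun do rewrite imM; apply: cvgD; apply: cvgM.
Qed.

Lemma cvgCN z w : cvgC U z w -> cvgC U (fun k => - z k) (- w).
Proof.
move=> h; rewrite -mulN1r.
by under eq_fun do rewrite -mulN1r; apply: cvgCM h; apply: cvgC_cst.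
Qed.

Lemma cvgC_conj z w : cvgC U z w -> cvgC U (fun k => Num.conj (z k)) (Num.conj w).
Proof.
have reJ (x : R[i]) : complex.Re (Num.conj x) = complex.Re x by case: x.
have imJ (x : R[i]) : complex.Im (Num.conj x) = - complex.Im x by case: x.
move=> [h1 h2]; split; rewrite ?reJ ?imJ.
  by under eq_fun do rewrite reJ.
by under eq_fun do rewrite imJ; apply: cvgN.
Qed.

Lemma cvgC_sum (I : Type) (r : seq I) (P : pred I) (z : I -> nat -> R[i]) (w : I -> R[i]) :
  (forall i, cvgC U (z i) (w i)) ->
  cvgC U (fun k => \sum_(i <- r | P i) z i k) (\sum_(i <- r | P i) w i).
Proof.
move=> h; elim: r => [|i r IH].
  by rewrite big_nil; under eq_fun do rewrite big_nil; apply: cvgC_cst.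
rewrite big_cons; under eq_fun do rewrite big_cons.
by case: (P i) => //; apply: cvgCD.
Qed.

Lemma cvgC_prod (I : Type) (r : seq I) (P : pred I) (z : I -> nat -> R[i]) (w : I -> R[i]) :
  (forall i, cvgC U (z i) (w i)) ->
  cvgC U (fun k => \prod_(i <- r | P i) z i k) (\prod_(i <- r | P i) w i).
Proof.
move=> h; elim: r => [|i r IH].
  by rewrite big_nil; under eq_fun do rewrite big_nil; apply: cvgC_cst.
rewrite big_cons; under eq_fun do rewrite big_cons.
by case: (P i) => //; apply: cvgCM.
Qed.

Lemma cvg_normc z w :
  cvgC U z w -> (normc (z k) @[k --> U] --> normc w)%classic.
Proof.
have nE (x : R[i]) : normc x = Num.sqrt (complex.Re x ^+ 2 + complex.Im x ^+ 2) by case: x.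
move=> [h1 h2]; rewrite nE; under eq_fun do rewrite nE.
apply: (@continuous_cvg _ _ _ _ _ _ Num.sqrt); first exact: sqrt_continuous.
by apply: cvgD; rewrite expr2; under eq_fun do rewrite expr2; apply: cvgM.
Qed.

Lemma cvgC_unique z w1 w2 : cvgC U z w1 -> cvgC U z w2 -> w1 = w2.
Proof.
move=> [r1 i1] [r2 i2].
have er := cvg_unique (@Rhausdorff R) r1 r2.
have ei := cvg_unique (@Rhausdorff R) i1 i2.
by apply/eqP; rewrite eq_complex er ei !eqxx.
Qed.

Lemma cvgmxM p q s (A : nat -> 'M[R[i]]_(p, q)) (B : nat -> 'M[R[i]]_(q, s)) A' B' :
  cvgmx U A A' -> cvgmx U B B' -> cvgmx U (fun k => A k *m B k) (A' *m B').
Proof.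
move=> hA hB i j; rewrite mxE; under eq_fun do rewrite mxE.
by apply: cvgC_sum => k; apply: cvgCM.
Qed.

Lemma cvgmxD p q (A B : nat -> 'M[R[i]]_(p, q)) A' B' :
  cvgmx U A A' -> cvgmx U B B' -> cvgmx U (fun k => A k + B k) (A' + B').
Proof.
move=> hA hB i j; rewrite mxE; under eq_fun do rewrite mxE.
exact: cvgCD.
Qed.

Lemma cvgmxN p q (A : nat -> 'M[R[i]]_(p, q)) A' :
  cvgmx U A A' -> cvgmx U (fun k => - A k) (- A').
Proof.
move=> hA i j; rewrite mxE; under eq_fun do rewrite mxE.
exact: cvgCN.
Qed.

Lemma cvgmxZ p q c (A : nat -> 'M[R[i]]_(p, q)) A' :
  cvgmx U A A' -> cvgmx U (fun k => c *: A k) (c *: A').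
Proof.
move=> hA i j; rewrite mxE; under eq_fun do rewrite mxE.
by apply: cvgCM => //; apply: cvgC_cst.
Qed.

Lemma cvgmx_cst p q (A : 'M[R[i]]_(p, q)) : cvgmx U (fun=> A) A.
Proof. by move=> i j; apply: cvgC_cst. Qed.

Lemma cvgmx_adj p q (A : nat -> 'M[R[i]]_(p, q)) A' :
  cvgmx U A A' -> cvgmx U (fun k => (A k)^t*) (A'^t*).
Proof.
move=> hA i j; rewrite !mxE; under eq_fun do rewrite !mxE.
exact: cvgC_conj.
Qed.

Lemma cvgmx_scalar p z w : cvgC U z w -> cvgmx U (fun k => (z k)%:M) (w%:M : 'M[R[i]]_p).
Proof.
move=> h i j; rewrite mxE; under eq_fun do rewrite mxE.
by case: (i == j); [exact: h | apply: cvgC_cst].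
Qed.

Lemma cvgC_det p (A : nat -> 'M[R[i]]_p) A' :
  cvgmx U A A' -> cvgC U (fun k => \det (A k)) (\det A').
Proof.
move=> hA; apply: cvgC_sum => s; apply: cvgCM; first exact: cvgC_cst.
by apply: cvgC_prod => i; apply: hA.
Qed.

Lemma cvgC_tr p (A : nat -> 'M[R[i]]_p) A' :
  cvgmx U A A' -> cvgC U (fun k => \tr (A k)) (\tr A').
Proof. by move=> hA; apply: cvgC_sum => i; apply: hA. Qed.

Lemma cvg_rsum (I : Type) (r : seq I) (u : I -> nat -> R) (x : I -> R) :
  (forall i, (u i k @[k --> U] --> x i)%classic) ->
  ((\sum_(i <- r) u i k) @[k --> U] --> \sum_(i <- r) x i)%classic.
Proof.
move=> h; elim: r => [|i r IH].
  by rewrite big_nil; under eq_fun do rewrite big_nil; apply: cvg_cst.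
by rewrite big_cons; under eq_fun do rewrite big_cons; apply: cvgD.
Qed.

Lemma cvg_rprod (I : Type) (r : seq I) (P : pred I) (u : I -> nat -> R) (x : I -> R) :
  (forall i, (u i k @[k --> U] --> x i)%classic) ->
  ((\prod_(i <- r | P i) u i k) @[k --> U] --> \prod_(i <- r | P i) x i)%classic.
Proof.
move=> h; elim: r => [|i r IH].
  by rewrite big_nil; under eq_fun do rewrite big_nil; apply: cvg_cst.
by rewrite big_cons; under eq_fun do rewrite big_cons; case: (P i) => //; apply: cvgM.
Qed.

Lemma cvg_frob2 p q (A : nat -> 'M[R[i]]_(p, q)) A' :
  cvgmx U A A' -> (frob2 (A k) @[k --> U] --> frob2 A')%classic.
Proof.
move=> hA; apply: cvg_rsum => i; apply: cvg_rsum => j.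
rewrite expr2; under eq_fun do rewrite expr2.
by apply: cvgM; apply: cvg_normc; apply: hA.
Qed.

End UltraLimits.

(* The eigenvalues [st_l] of [A + r F] and the inverse [st_Q] of [m - F^* F] are kept as
   separate parameters, so that feasibility is a closed condition. *)
Record state (R : realType) (n : nat) := State {
  st_F : 'M[R[i]]_n; st_l : 'I_n -> R[i]; st_m : R; st_Q : 'M[R[i]]_n }.

Section Maximizer.
Variables (R : realType) (n : nat) (A : 'M[R[i]]_n) (r th c N : R).
Hypotheses (n0 : (0 < n)%N) (th0 : 0 < th).
Implicit Type s : state R n.

(* Minimised over [m], this is the smoothed value of [||F||^2]. *)
Definition soft_level s : R := st_m s + th * complex.Re (\tr (st_Q s)).

(** The level bound makes this set compact: it bounds [m] and the trace of [Q], hence the entries of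
    [Q]; then [m] bounds [F], and [F] bounds the eigenvalues. *)
Definition feasible s : Prop :=
  [/\ spectrum (A + r%:C *: st_F s) (st_l s),
      st_Q s *m ((st_m s)%:C%:M - (st_F s)^t* *m st_F s) = 1%:M,
      sq_contr (st_m s) (st_F s) & soft_level s <= 1].

(** The modulus of the discriminant: each pair of eigenvalues occurs in both orders. *)
Definition vander (l : 'I_n -> R[i]) : R := \prod_i \prod_(j | j != i) normc (l i - l j).

(** The exponential of [N] times the functional. It is continuous on all feasible states and
    vanishes when two eigenvalues collide, where the logarithm of the discriminant would be
    undefined. *)
Definition objective s : R :=
  vander (st_l s) * expR (N * (\sum_i normc (st_l s i) ^+ 2 - c * soft_level s)).

Lemma frob2_delta (j : 'I_n) : frob2 (delta_mx j (0 : 'I_1) : 'cV[R[i]]_n) = 1.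
Proof.
apply: (@complexI R); rewrite frob2_tr trmx_delta map_delta_mx mul_delta_mx.
by rewrite /mxtrace big_ord1 mxE eqxx.
Qed.

Lemma sq_contr_entry m (F : 'M[R[i]]_n) i j : sq_contr m F -> normc (F i j) ^+ 2 <= m.
Proof.
move=> /(_ (delta_mx j 0)); rewrite frob2_delta mulr1; apply: le_trans.
by have := normc_le_frob2 (F *m delta_mx j (0 : 'I_1)) i 0; rewrite -colE mxE.
Qed.

Lemma spectrum_bound (M : 'M[R[i]]_n) (l : 'I_n -> R[i]) B i :
  spectrum M l -> (forall v : 'cV[R[i]]_n, frob2 (M *m v) <= B * frob2 v) ->
  normc (l i) ^+ 2 <= B.
Proof.
move=> hs hB.
(* [det0P] yields a row vector in the kernel; for the transpose, this is a right eigenvector of [M],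
   to which [hB] applies. *)
have : \det (((l i)%:M - M)^T) == 0 by rewrite det_tr hs (bigD1 i) //= subrr mul0r.
move=> /det0P [v v0] /(congr1 trmx); rewrite trmx_mul trmxK trmx0.
rewrite mulmxBl mul_scalar_mx => /eqP; rewrite subr_eq0 => /eqP hv.
have := hB v^T; rewrite -hv frob2Z ler_pM2r //.
rewrite lt_def frob2_ge0 andbT; apply: contra v0 => /eqP/frob2_eq0/(congr1 trmx).
by rewrite trmxK trmx0 => ->.
Qed.

Lemma feasible_m s : feasible s -> 0 <= st_m s <= 1.
Proof.
move=> [_ h2 h3 h4]; apply/andP; split.
  exact: le_trans (sqr_ge0 _) (sq_contr_entry (Ordinal n0) (Ordinal n0) h3).
apply: le_trans h4; rewrite lerDl mulr_ge0 ?(ltW th0) //.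
exact: resolvent_tr_ge0 h2 h3.
Qed.

Lemma feasible_Q s i j : feasible s -> normc (st_Q s i j) <= th^-1.
Proof.
move=> fs; have /andP[m0 _] := feasible_m fs; case: fs => [_ h2 h3 h4].
apply: le_trans (resolvent_entry_le h2 h3 i j) _.
rewrite -[leRHS]mul1r ler_pdivlMr // mulrC; move: h4; rewrite /soft_level; lra.
Qed.

Lemma feasible_F s i j : feasible s -> normc (st_F s i j) <= 1.
Proof.
move=> fs; have /andP[m0 m1] := feasible_m fs; case: fs => [_ _ h3 _].
rewrite -(@ler_pXn2r _ 2) ?nnegrE ?normc_ge0 // expr1n.
exact: le_trans (sq_contr_entry i j h3) m1.
Qed.

Lemma feasible_l s i :
  feasible s -> normc (st_l s i) <= enorm A + `|r| * \sum_(j < n) \sum_(k < n) 1.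
Proof.
move=> fs; apply: le_trans (_ : enorm (A + r%:C *: st_F s) <= _).
  rewrite -(@ler_pXn2r _ 2) ?nnegrE ?normc_ge0 ?enorm_ge0 //.
  case: fs => [h1 _ _ _]; apply: spectrum_bound h1 _ => v.
  by apply: le_trans (frob2M _ _) _; rewrite ler_wpM2r ?frob2_ge0 ?frob2_le_enorm.
apply: le_trans (enormD _ _) _; rewrite lerD2l enormZ normc_real ler_wpM2l //.
by do 2!apply: ler_sum => ? _; apply: feasible_F.
Qed.

(** All components of feasible states are bounded, so they converge along [U]; each clause of
    [feasible] is an equation or a weak inequality between continuous functions of them. *)
Lemma feasible_limit (U : set_system nat) (p : nat -> state R n) :
  UltraFilter U -> (forall k, feasible (p k)) ->
  exists2 s, feasible s & (objective (p k) @[k --> U] --> objective s)%classic.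
Proof.
move=> FU fp.
have hF i j := @ultra_bounded_cvgC _ U FU _ _ (fun k => feasible_F i j (fp k)).
have [F cF] := choice (fun e : 'I_n * 'I_n => hF e.1 e.2).
have hQ i j := @ultra_bounded_cvgC _ U FU _ _ (fun k => feasible_Q i j (fp k)).
have [Q cQ] := choice (fun e : 'I_n * 'I_n => hQ e.1 e.2).
have hl i := @ultra_bounded_cvgC _ U FU _ _ (fun k => feasible_l i (fp k)).
have [l cl] := choice hl.
have hm k : `|st_m (p k)| <= 1.
  by have /andP[? ?] := feasible_m (fp k); rewrite ger0_norm.
have [m cm] := @ultra_bounded_cvg _ U FU _ _ hm.
pose s := State (\matrix_(i, j) F (i, j)) l m (\matrix_(i, j) Q (i, j)).
have cF' : cvgmx U (fun k => st_F (p k)) (st_F s) by move=> i j; rewrite mxE; apply: (cF (i, j)).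
have cQ' : cvgmx U (fun k => st_Q (p k)) (st_Q s) by move=> i j; rewrite mxE; apply: (cQ (i, j)).
have clev : (soft_level (p k) @[k --> U] --> soft_level s)%classic.
  apply: cvgD => //; apply: cvgM; first exact: cvg_cst.
  by have [] := cvgC_tr cQ'.
exists s.
  split.
  - move=> x; apply: (@cvgC_unique _ U _ (fun k => \det (x%:M - (A + r%:C *: st_F (p k))))).
      apply: cvgC_det; apply: cvgmxD; first exact: cvgmx_cst.
      by apply: cvgmxN; apply: cvgmxD; [apply: cvgmx_cst | apply: cvgmxZ].
    have -> : (fun k => \det (x%:M - (A + r%:C *: st_F (p k)))) =
              (fun k => \prod_i (x - st_l (p k) i)).
      by apply/funext => k; case: (fp k).
    apply: cvgC_prod => i; apply: cvgCD; first exact: cvgC_cst.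
    by apply: cvgCN.
  - apply/matrixP => i j.
    apply: (@cvgC_unique _ U _ (fun k =>
      (st_Q (p k) *m ((st_m (p k))%:C%:M - (st_F (p k))^t* *m st_F (p k))) i j)).
      apply: cvgmxM => //; apply: cvgmxD; first by apply: cvgmx_scalar; apply: cvgC_real.
      by apply: cvgmxN; apply: cvgmxM => //; apply: cvgmx_adj.
    have -> : (fun k => (st_Q (p k) *m
        ((st_m (p k))%:C%:M - (st_F (p k))^t* *m st_F (p k))) i j) = (fun=> 1%:M i j).
      by apply/funext => k; case: (fp k) => _ ->.
    exact: cvgC_cst.
  - move=> v.
    have c1 : (frob2 (st_F (p k) *m v) @[k --> U] --> frob2 (st_F s *m v))%classic.
      by apply: cvg_frob2; apply: cvgmxM => //; apply: cvgmx_cst.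
    have c2 : (st_m (p k) * frob2 v @[k --> U] --> m * frob2 v)%classic.
      by apply: cvgM => //; apply: cvg_cst.
    rewrite -subr_ge0; apply: cvgr_to_ge (cvgB c2 c1) _.
    by apply: nearW => k; rewrite /= subr_ge0; case: (fp k).
  - by apply: cvgr_to_le clev _; apply: nearW => k; case: (fp k).
apply: cvgM.
  apply: cvg_rprod => i; apply: cvg_rprod => j; apply: cvg_normc.
  by apply: cvgCD => //; apply: cvgCN.
apply: (@continuous_cvg _ _ _ _ _ _ expR); first exact: continuous_expR.
apply: cvgM; first exact: cvg_cst.
apply: cvgB; last by apply: cvgM clev; apply: cvg_cst.
apply: cvg_rsum => i; rewrite expr2; under eq_fun do rewrite expr2.
by apply: cvgM; apply: cvg_normc.
Qed.

Lemma maximizer_exists s0 :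
  feasible s0 ->
  exists2 s, feasible s & forall s', feasible s' -> objective s' <= objective s.
Proof.
move=> f0.
have [U [FU hU]] := @ultraFilterLemma nat \oo%classic _.
pose S : set R := [set x | exists2 s, feasible s & objective s = x]%classic.
(* One limit argument serves twice: with [b k] = k it shows that the objective is bounded, and with
   [b k] = sup S - 1/(k+1) that the supremum is attained. *)
have ext (b : nat -> R) : (forall k, exists2 s, feasible s & b k <= objective s) ->
    exists2 s, feasible s &
      forall a, (\forall k \near \oo%classic, a <= b k) -> a <= objective s.
  move=> hb.
  have /choice [p hp] : forall k, exists s, feasible s /\ b k <= objective s.
    by move=> k; have [s ? ?] := hb k; exists s.
  have [s fs cs] := feasible_limit FU (fun k => (hp k).1).
  exists s => // a ha; apply: cvgr_to_ge cs _.
  by apply: hU; apply: filterS ha => k /le_trans; apply; apply: (hp k).2.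
have hS : has_sup S.
  split; first by exists (objective s0), s0.
  apply: contrapT => hn.
  have [k|s fs hs] := ext (fun k => k%:R).
    apply: contrapT => hk; apply: hn; exists k%:R => _ [s fs <-].
    by rewrite leNgt; apply/negP => hlt; apply: hk; exists s => //; apply: ltW.
  have := hs (Num.bound `|objective s|)%:R.
  have h1 : \forall k \near \oo%classic, ((Num.bound `|objective s|)%:R : R) <= k%:R.
    by exists (Num.bound `|objective s|) => // k /=; rewrite ler_nat.
  move=> /(_ h1); apply/negP; rewrite -ltNge.
  exact: le_lt_trans (ler_norm _) (archi_boundP (normr_ge0 _)).
have [k|s fs hs] := ext (fun k => sup S - k.+1%:R^-1).
  have k0 : 0 < k.+1%:R^-1 :> R by rewrite invr_gt0.
  by have [_ [s fs <-] hlt] := sup_adherent k0 hS; exists s => //; apply: ltW.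
exists s => // s' fs'.
apply: (@le_trans _ _ (sup S)); first by apply: ub_le_sup; [exact: hS.2 | exists s'].
apply/ler_addgt0Pr => e e0; rewrite -lerBlDr; apply: hs.
have := near_infty_natSinv_lt (PosNum e0).
by apply: filterS => k hk; rewrite lerD2l lerN2 ltW.
Qed.

End Maximizer.

(** * Four-point sums and products, and inequalities in one small parameter *)

Section RealLemmas.
Variable R : realType.

Lemma normc_parallelogram (x y : R[i]) :
  normc (x + y) ^+ 2 + normc (x - y) ^+ 2 = (normc x ^+ 2 + normc y ^+ 2) *+ 2.
Proof.
have nE (w : R[i]) : normc w ^+ 2 = complex.Re w ^+ 2 + complex.Im w ^+ 2.
  by case: w => a b /=; rewrite sqr_sqrtr // addr_ge0 ?sqr_ge0.
rewrite !nE; case: x y => a b [d e] /=; ring.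
Qed.

Lemma four_normc_sqr (x y z : R[i]) :
  four (fun w => normc (x + w * y) ^+ 2) z =
  (normc x ^+ 2 + normc z ^+ 2 * normc y ^+ 2) *+ 4.
Proof.
rewrite /four !mulNr.
have h1 := normc_parallelogram x (z * y); have h2 := normc_parallelogram x ('i%R * z * y).
have e1 : normc (z * y) ^+ 2 = normc z ^+ 2 * normc y ^+ 2 by rewrite normcM exprMn.
have e2 : normc ('i%R * z * y) ^+ 2 = normc z ^+ 2 * normc y ^+ 2.
  by rewrite normcM normc_i exprMn.
rewrite e1 in h1; rewrite e2 in h2; lra.
Qed.

(** The four factors are x + u z y with u running over the fourth roots of unity. This is the
    discrete form of the harmonicity of log |x + w y|: the deviation only starts at order 4. *)
Lemma four_prod_norm (x y z : R[i]) :
  normc (x + z * y) * normc (x + 'i%R * z * y) * normc (x + - z * y) * normc (x + - ('i%R * z) * y)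
  = normc (x ^+ 4 - z ^+ 4 * y ^+ 4).
Proof.
rewrite -!normcM; congr normc.
have -> : (x + z * y) * (x + 'i * z * y) * (x + - z * y) * (x + - ('i * z) * y) =
  (x ^+ 2 - (z * y) ^+ 2) * (x ^+ 2 - 'i ^+ 2 * (z * y) ^+ 2) by ring.
by rewrite sqrCi; ring.
Qed.

(** A form of the Weierstrass product inequality in which the factors may exceed 1. *)
Lemma prod_ge_1sub (I : Type) (s : seq I) (P : pred I) (f K : I -> R) :
  (forall i, 0 <= f i) -> (forall i, 0 <= K i) -> (forall i, 1 - K i <= f i) ->
  1 - \sum_(i <- s | P i) K i <= \prod_(i <- s | P i) f i.
Proof.
move=> f0 K0 h.
suff : [/\ 1 - \sum_(i <- s | P i) K i <= \prod_(i <- s | P i) f i,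
  0 <= \prod_(i <- s | P i) f i & 0 <= \sum_(i <- s | P i) K i] by case.
split; [|exact: prodr_ge0|exact: sumr_ge0].
elim: s => [|i s IH]; first by rewrite !big_nil subr0.
rewrite !big_cons; case: (P i) => //.
have p0 : 0 <= \prod_(j <- s | P j) f j by apply: prodr_ge0.
have s0 : 0 <= \sum_(j <- s | P j) K j by apply: sumr_ge0.
move: (f0 i) (K0 i) (h i) IH p0 s0.
move: (f i) (K i) (\prod_(j <- s | P j) f j) (\sum_(j <- s | P j) K j) => a k p q a0 k0 ak pq p0 q0.
have [h1|h1] := leP (1 - (k + q)) 0; first by apply: le_trans h1 _; apply: mulr_ge0.
have : (1 - k) * (1 - q) <= a * p by apply: ler_pM => //; lra.
have := mulr_ge0 k0 q0; lra.
Qed.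

Lemma le0_of_quadratic (a C e : R) :
  0 < e -> (forall x, 0 < x < e -> a * x <= C * x ^+ 2) -> a <= 0.
Proof.
move=> e0 h; rewrite leNgt; apply/negP => a0.
have C1 : 0 < `|C| + 1 by rewrite ltr_wpDl.
pose x := Num.min (e / 2) (a / (2 * (`|C| + 1))).
have x0 : 0 < x by rewrite lt_min !divr_gt0 // mulr_gt0.
have xe : x < e by rewrite gt_min; apply/orP; left; lra.
have xa : x * (2 * (`|C| + 1)) <= a.
  by rewrite -ler_pdivlMr ?mulr_gt0 // ge_min lexx orbT.
have := h x; rewrite x0 xe => /(_ isT); rewrite expr2 mulrA ler_pM2r //.
have := ler_norm C; nra.
Qed.

(** If [S] were positive, exp y >= 1 + y would make the left side exceed 1 by about 4 N S x^2, which
    dominates the errors of order x^3 for small [x]. *)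
Lemma le0_of_exp_quadratic (S C K N e : R) :
  0 < e -> 0 < N -> 0 <= K ->
  (forall x, 0 < x < e -> (1 - K * x ^+ 4) * expR (N * (4 * x ^+ 2 * S - C * x ^+ 3)) <= 1) ->
  S <= 0.
Proof.
move=> e0 N0 K0 h; rewrite leNgt; apply/negP => S0.
(* Bounds the exponent for all [x <= 1], so that the product of K x^4 with 1 + y is an error of
   order x^3. *)
pose Y := N * (4 * S + `|C|).
pose d := Num.min e (K + 1)^-1.
have K1 : 0 < K + 1 by rewrite ltr_wpDl.
have d0 : 0 < d by rewrite lt_min e0 invr_gt0.
suff : N * S * 4 <= 0 by rewrite leNgt !mulr_gt0.
apply: (@le0_of_quadratic _ (N * `|C| + K * (1 + Y)) d) => // x /andP[x0].
rewrite lt_min => /andP[xe xK].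
have x1 : x <= 1.
  by apply: le_trans (ltW xK) _; rewrite invf_le1 // lerDr.
have Kx : K * x <= 1.
  have : x * (K + 1) <= 1 by rewrite -ler_pdivlMr // div1r ltW.
  lra.
have := h x; rewrite x0 xe => /(_ isT).
set y := N * _.
have hy := expR_ge1Dx y.
have x2 : x ^+ 2 <= 1 by rewrite expr_le1 // ltW.
have x3 : x ^+ 3 <= 1 by rewrite expr_le1 // ltW.
have x30 : 0 < x ^+ 3 by rewrite exprn_gt0.
have x43 : x ^+ 4 <= x ^+ 3 by rewrite [x ^+ 4]exprS ler_piMl // ltW.
have x40 : 0 < x ^+ 4 by rewrite exprn_gt0.
have Kx4 : K * x ^+ 4 <= 1.
  by apply: le_trans Kx; rewrite ler_wpM2l // exprS ler_piMr // ltW.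
have yY : y <= Y.
  rewrite /y /Y ler_pM2l //; have := ler_norm (- C); rewrite normrN.
  have := normr_ge0 C; move: x2 x3 x30 S0; nra.
have cC : C * x ^+ 3 <= `|C| * x ^+ 3 by rewrite ler_wpM2r ?ler_norm // ltW.
move=> hle.
have h1 : (1 - K * x ^+ 4) * (1 + y) <= 1.
  by apply: le_trans hle; rewrite ler_wpM2l // subr_ge0.
have h2 : y <= K * (1 + Y) * x ^+ 3.
  have Y0 : 0 <= 1 + Y by rewrite /Y; have := normr_ge0 C; move: N0 S0; nra.
  have h3 : K * x ^+ 4 * (1 + y) <= K * x ^+ 4 * (1 + Y).
    by rewrite ler_wpM2l ?lerD2l // mulr_ge0 // ltW.
  have h4 : K * (1 + Y) * x ^+ 4 <= K * (1 + Y) * x ^+ 3.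
    by rewrite ler_wpM2l // mulr_ge0.
  lra.
have h5 : N * S * 4 * x ^+ 2 <= (N * `|C| + K * (1 + Y)) * x ^+ 3.
  move: h2; rewrite /y; move: cC N0; nra.
by move: h5; rewrite expr2 exprS expr2 !mulrA ler_pM2r // -mulrA.
Qed.

End RealLemmas.

(** * Second-order conditions at a maximiser *)

Lemma scale_curve (K : fieldType) n (A F H N2 E : 'M[K]_n) (r z : K) : r != 0 ->
  A + r *: (F + z *: H + (z ^+ 2 *: (r^-1 *: N2) + r^-1%:M *m E)) =
  A + r *: F + z *: (r *: H) + (z ^+ 2 *: N2 + E).
Proof.
by move=> r0; rewrite mul_scalar_mx; apply/matrixP => i j; rewrite !mxE; field.
Qed.

Lemma Re_tr_le (R : realType) n (X : 'M[R[i]]_n) : `|complex.Re (\tr X)| <= enorm X.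
Proof. exact: le_trans (Re_le_normc _) (normc_trace _). Qed.

Lemma Re_trB (R : realType) n (X Y : 'M[R[i]]_n) :
  complex.Re (\tr (X - Y)) = complex.Re (\tr X) - complex.Re (\tr Y).
Proof. by rewrite linearB raddfB. Qed.

Lemma Re_trD (R : realType) n (X Y : 'M[R[i]]_n) :
  complex.Re (\tr (X + Y)) = complex.Re (\tr X) + complex.Re (\tr Y).
Proof. by rewrite mxtraceD raddfD. Qed.

Lemma Re_trDZ (R : realType) n (x y : R) (X Y : 'M[R[i]]_n) :
  complex.Re (\tr (x%:C *: X + y%:C *: Y)) =
  x * complex.Re (\tr X) + y * complex.Re (\tr Y).
Proof.
have reM (a : R) (w : R[i]) : complex.Re (a%:C * w) = a * complex.Re w.
  by case: w => u v /=; rewrite mul0r subr0.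
by rewrite Re_trD !mxtraceZ !reM.
Qed.

Lemma vander_gt0_inj (R : realType) n (l : 'I_n -> R[i]) : 0 < vander l -> injective l.
Proof.
move=> v0 i j hij; apply/eqP; apply/negPn/negP => ij.
move: v0; rewrite /vander (bigD1 i) //= (bigD1 j) /=; last by rewrite eq_sym.
by rewrite hij subrr normc0 !mul0r ltxx.
Qed.

Lemma vander_ge0 (R : realType) n (l : 'I_n -> R[i]) : 0 <= vander l.
Proof. by do 2!apply: prodr_ge0 => ? _; apply: normc_ge0. Qed.

(** Every difference of two eigenvalues is affine in [w], so the four values multiply to the fourth
    power of the discriminant times factors |1 - z^4 q|, with no term of order below 4. *)
Lemma vander_four (R : realType) n (l b : 'I_n -> R[i]) (z : R[i]) :
  injective l ->
  let v w := vander (fun i => l i + w * b i) in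
  let K := \sum_i \sum_(j | j != i) normc (((b i - b j) / (l i - l j)) ^+ 4) in
  is_true (vander l ^+ 4 * (1 - K * normc z ^+ 4) <=
    v z * v ('i%R * z) * v (- z) * v (- ('i%R * z))).
Proof.
move=> linj v K.
pose q i j := ((b i - b j) / (l i - l j)) ^+ 4.
have -> : v z * v ('i%R * z) * v (- z) * v (- ('i%R * z)) =
    vander l ^+ 4 * \prod_i \prod_(j | j != i) normc (1 - z ^+ 4 * q i j).
  rewrite /v /vander -prodrXl -!big_split /=; apply: eq_bigr => i _.
  rewrite -prodrXl -!big_split /=; apply: eq_bigr => j ij.
  have d0 : l i - l j != 0 by rewrite subr_eq0; apply: contra_neq ij => /linj.
  have e w : l i + w * b i - (l j + w * b j) = (l i - l j) + w * (b i - b j) by ring.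
  rewrite !e four_prod_norm.
  have -> : (l i - l j) ^+ 4 - z ^+ 4 * (b i - b j) ^+ 4 =
      (l i - l j) ^+ 4 * (1 - z ^+ 4 * q i j).
    by rewrite /q exprMn exprVn mulrBr mulr1; congr (_ - _); field.
  by rewrite normcM; congr (_ * _); rewrite !exprS expr0 !normcM normc1.
apply: ler_wpM2l; first by rewrite exprn_ge0 // vander_ge0.
rewrite /K mulr_suml; apply: prod_ge_1sub => i.
- by apply: prodr_ge0 => j _; apply: normc_ge0.
- by rewrite mulr_ge0 ?exprn_ge0 ?normc_ge0 // sumr_ge0 // => j _; apply: normc_ge0.
rewrite mulr_suml; apply: prod_ge_1sub => j; first exact: normc_ge0.
  by rewrite mulr_ge0 ?exprn_ge0 ?normc_ge0.
have := le_normcD (1 - z ^+ 4 * q i j) (z ^+ 4 * q i j).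
rewrite subrK normc1 normcM.
have -> : normc (z ^+ 4) = normc z ^+ 4.
  by rewrite !exprS expr0 !normcM normc1.
by rewrite mulrC -/(q i j); lra.
Qed.

Lemma prod4_le (R : realType) (a1 a2 a3 a4 b : R) :
  0 <= a1 -> 0 <= a2 -> 0 <= a3 -> 0 <= a4 ->
  a1 <= b -> a2 <= b -> a3 <= b -> a4 <= b -> a1 * a2 * a3 * a4 <= b ^+ 4.
Proof.
move=> *; rewrite -[b ^+ 4]/(b * (b * (b * b))) !mulrA.
by do 3!(apply: ler_pM; rewrite ?mulr_ge0 //).
Qed.

Lemma prod4_expR (R : realType) (v1 v2 v3 v4 g1 g2 g3 g4 N : R) :
  v1 * expR (N * g1) * (v2 * expR (N * g2)) * (v3 * expR (N * g3)) * (v4 * expR (N * g4)) =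
  v1 * v2 * v3 * v4 * expR (N * (g1 + g2 + g3 + g4)).
Proof. by rewrite !mulrDr !expRD; ring. Qed.

Lemma Re_tr_four (R : realType) n (X1 X2 X3 X4 Q T : 'M[R[i]]_n) (y : R) :
  complex.Re (\tr (X1 + X2 + X3 + X4 - (Q + y%:C *: T) *+ 4)) =
  complex.Re (\tr (X1 - Q)) + complex.Re (\tr (X2 - Q)) +
  complex.Re (\tr (X3 - Q)) + complex.Re (\tr (X4 - Q)) - 4 * (y * complex.Re (\tr T)).
Proof.
have -> : (Q + y%:C *: T) *+ 4 = 4%:C *: Q + (4 * y)%:C *: T.
  by rewrite mulrnDl -[Q *+ 4]scaler_nat scalerMnl rmorphM /= rmorph_nat mulr_natl.
by rewrite !Re_trB Re_trDZ !Re_trD; ring.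
Qed.

Lemma second_order_gain (R : realType) (s1 s2 s3 s4 a b c x th L T d1 d2 d3 d4 : R) :
  s1 + s2 + s3 + s4 = (a + x * b) *+ 4 ->
  s1 - c * (L + th * d1) + (s2 - c * (L + th * d2)) + (s3 - c * (L + th * d3))
    + (s4 - c * (L + th * d4)) =
  (a - c * L) *+ 4 + (4 * x * (b - c * th * T)
    - c * th * (d1 + d2 + d3 + d4 - 4 * (x * T))).
Proof. by move=> h; lra. Qed.

Lemma second_order_exponent (R : realType) (N d S x k G g err : R) :
  0 <= N -> 0 <= d -> G = g *+ 4 + (4 * x ^+ 2 * S - d * err) -> err <= k * x ^+ 3 ->
  N * (4 * x ^+ 2 * S - d * k * x ^+ 3) <= N * G - 4%:R * (N * g).
Proof.
move=> N0 d0 -> he; have h := ler_wpM2l d0 he.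
have -> : N * (g *+ 4 + (4 * x ^+ 2 * S - d * err)) - 4%:R * (N * g) =
  N * (4 * x ^+ 2 * S - d * err) by ring.
by apply: ler_wpM2l => //; lra.
Qed.

Lemma mul_expR_le1 (R : realType) (v p V y E1 E0 : R) :
  0 < v -> 0 <= p -> v * p <= V -> V * expR E1 <= v * expR E0 -> y <= E1 - E0 ->
  p * expR y <= 1.
Proof.
move=> v0 p0 hV hE hy.
apply: le_trans (_ : p * expR (E1 - E0) <= _); first by rewrite ler_wpM2l // ler_expR.
rewrite expRD expRN mulrA ler_pdivrMr ?expR_gt0 // mul1r -(ler_pM2l v0) mulrA.
by apply: le_trans hE; rewrite ler_wpM2r ?expR_ge0.
Qed.

Section Optimum.
Variables (R : realType) (n : nat) (A : 'M[R[i]]_n) (r th c N : R) (s : state R n).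
Hypotheses (n0 : (0 < n)%N) (th0 : 0 < th) (c0 : 0 < c) (N0 : 0 < N).
Hypotheses (fs : feasible A r th s) (ls : soft_level th s < 1) (vs : 0 < vander (st_l s)).
Hypothesis maxs : forall s', feasible A r th s' -> objective th c N s' <= objective th c N s.

Let QP : st_Q s *m ((st_m s)%:C%:M - (st_F s)^t* *m st_F s) = 1%:M.
Proof. by case: fs. Qed.

Let Fs : sq_contr (st_m s) (st_F s). Proof. by case: fs. Qed.

(* Stationarity in [m]. *)
Lemma optimal_mult : th * frob2 (st_Q s) <= 1.
Proof.
have qP := QP; set Q := st_Q s in qP *; set m := st_m s in qP *; set F := st_F s in qP *.
(* With this [D], [P - D x] is the matrix belonging to [m + x]. Only increases of [m] are tried:
   they preserve [sq_contr], and one side is enough for an inequality. *)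
pose D (z : R[i]) : 'M[R[i]]_n := - (z *: 1%:M).
have hD : bigO 1 D by apply: bigON; apply: bigOZ; apply: bigO_const.
have [K K0 hK] := resolvent_first qP hD.
(* The slack in the level constraint over a bound for the growth rate of the level: below this
   radius [m + x] stays feasible. *)
have e0 : 0 < (1 - soft_level th s) / (1 + th * K).
  by rewrite divr_gt0 ?subr_gt0 // ltr_wpDr // mulr_ge0 // ltW.
have [e e_gt0 he] := near0_and (near0_and (resolvent_unit qP hD) hK) (near0_small e0).
rewrite -subr_le0; apply: (@le0_of_quadratic _ _ (th * enorm Q * K) e) => // x /andP[x0 xe].
have nx : normc (x%:C : R[i]) = x by rewrite normc_real gtr0_norm.
have [[hu hk] hs] : (_ /\ _) /\ _ := he x%:C (eq_ind_r (fun y => y < e) xe nx).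
move: hk; rewrite nx expr1 => hk; rewrite nx in hs.
set P := _ - _ in qP hu hk.
have eP : P - D x%:C = (m + x)%:C%:M - F^t* *m F.
  by rewrite /P /D opprK scalemx1 rmorphD /= raddfD /= addrAC.
set Q' := invmx _ in hk.
have hQ' : Q' *m ((m + x)%:C%:M - F^t* *m F) = 1%:M by rewrite -eP mulVmx.
have step : Q' = Q - x%:C *: (Q *m Q) - x%:C *: (Q *m (Q' - Q)).
  rewrite {1}/Q' (resolvent_step qP hu) -/Q' /D mulmxN mulNmx -scalemxAr mulmx1 -scalemxAl.
  by rewrite (mulmxBr Q Q' Q); mx_abelian.
have trd : `|complex.Re (\tr (Q' - Q))| <= K * x := le_trans (Re_tr_le _) hk.
have lev : soft_level th (State F (st_l s) (m + x) Q') =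
    soft_level th s + x + th * complex.Re (\tr (Q' - Q)).
  by rewrite /soft_level /= Re_trB -/m -/Q; ring.
have fs' : feasible A r th (State F (st_l s) (m + x) Q').
  split=> //=.
  - by case: fs.
  - move=> v; apply: le_trans (Fs v) _; rewrite ler_wpM2r ?frob2_ge0 // lerDl ltW //.
  - have hs' : x * (1 + th * K) < 1 - soft_level th s.
      by rewrite -ltr_pdivlMr // ltr_wpDr // mulr_ge0 // ltW.
    have : th * complex.Re (\tr (Q' - Q)) <= th * (K * x).
      by rewrite ler_wpM2l ?(ltW th0) // (le_trans (ler_norm _) trd).
    rewrite lev; lra.
have := maxs fs'; rewrite /objective /= ler_pM2l // ler_expR ler_pM2l // lerD2l lerN2.
rewrite ler_pM2l // lev.
have eQ : complex.Re (\tr (Q *m Q)) = frob2 Q.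
  by rewrite -{1}(resolvent_adj qP) -frob2_tr.
have : complex.Re (\tr (Q' - Q)) = - x * frob2 Q - x * complex.Re (\tr (Q *m (Q' - Q))).
  have e1 : Q' - Q = (- x)%:C *: (Q *m Q) + (- x)%:C *: (Q *m (Q' - Q)).
    rewrite {1}step rmorphN !scaleNr.
    by move: (x%:C *: _) (x%:C *: _) => Y Z; mx_abelian.
  rewrite {1}e1.
  by rewrite Re_trDZ eQ; ring.
move=> -> hlev.
have h2 : `|complex.Re (\tr (Q *m (Q' - Q)))| <= enorm Q * (K * x).
  apply: le_trans (Re_tr_le _) (le_trans (enormM _ _) _).
  by rewrite ler_wpM2l ?enorm_ge0.
have h3 : th * (x * `|complex.Re (\tr (Q *m (Q' - Q)))|) <= th * (x * (enorm Q * (K * x))).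
  by rewrite !ler_wpM2l // ltW.
have h4 : - (th * (x * complex.Re (\tr (Q *m (Q' - Q))))) <= th * (x * `|complex.Re (\tr (Q *m (Q' - Q)))|).
  by rewrite -!mulrN ler_pM2l // ler_pM2l // -normrN ler_norm.
lra.
Qed.

(** The maximum inequalities at [z], [iz], [-z], [-iz] are multiplied, the objective being an
    exponential. With [m] fixed, the exponent gains 4 N |z|^2 times the difference of the two sides,
    up to O(|z|^3), while the discriminant loses at most a factor 1 - K |z|^4. *)
Lemma optimal_direction (V W H : 'M[R[i]]_n) :
  r != 0 -> W *m V = 1%:M -> A + r%:C *: st_F s = V *m diagf (st_l s) *m W ->
  \sum_i normc ((W *m (r%:C *: H) *m V) i i) ^+ 2 <=
  c * th * complex.Re (\tr (barrier_hess (st_F s) H (st_Q s))).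
Proof.
move=> r0 WV MV.
have qP := QP; have /andP[_ m1] := feasible_m n0 th0 fs.
set Q := st_Q s in qP *; set m := st_m s in qP m1 *; set F := st_F s in MV qP *.
set l := st_l s in MV *; pose b i := (W *m (r%:C *: H) *m V) i i.
have linj : injective l := vander_gt0_inj vs.
have [N2 [E0 [hE0 hspec]]] := eigen_curve (r%:C *: H) WV linj.
(* The curve of [eigen_curve] lives in the space of [A + r F]; dividing by [r] pulls it back to [F].
   The error is divided by a scalar matrix product so that [bigOM] applies. *)
pose H2 := r%:C^-1 *: N2; pose E3 z := r%:C^-1%:M *m E0 z.
have hE3 : bigO 3 E3 := bigOM (bigO_const _) hE0.
pose Fz (z : R[i]) := F + z *: H + (z ^+ 2 *: H2 + E3 z).
pose Qz z := invmx (m%:C%:M - (Fz z)^t* *m Fz z).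
pose sz z := State (Fz z) (fun i => l i + z * b i) m (Qz z).
have hD := gram_bigO1 F H H2 hE3.
have PD z : m%:C%:M - F^t* *m F - ((Fz z)^t* *m Fz z - F^t* *m F) = m%:C%:M - (Fz z)^t* *m Fz z.
  by rewrite opprB addrA subrK.
have rC0 : r%:C != 0 :> R[i] by rewrite (inj_eq (@complexI _)).
have hF z : A + r%:C *: Fz z = V *m diagf l *m W + z *: (r%:C *: H) + (z ^+ 2 *: N2 + E0 z).
  by rewrite -MV; apply: scale_curve.
have lev z : soft_level th (sz z) = soft_level th s + th * complex.Re (\tr (Qz z - Q)).
  by rewrite /soft_level /= Re_trB -/m -/Q; ring.
have d0 : 0 < (1 - soft_level th s) / th by rewrite divr_gt0 // subr_gt0.
have hfeas : near0 (fun z => feasible A r th (sz z)).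
  apply: near0_imp (near0_and (near0_and hspec (sq_contr_perturb qP Fs m1 hD))
    (near0_and (resolvent_unit qP hD) (bigO_enorm_small d0 (resolvent_first qP hD)))).
  move=> z [[h1 h2] [h3 h4]]; split => //.
  - by rewrite hF.
  - by rewrite /= /Qz -PD mulVmx.
  - rewrite PD in h4; rewrite lev.
    have h5 : complex.Re (\tr (Qz z - Q)) <= (1 - soft_level th s) / th.
      by apply: le_trans (ler_norm _) (le_trans (Re_tr_le _) h4).
    by move: h5; rewrite ler_pdivlMr // mulrC; lra.
have [e1 e10 hf] := hfeas.
have [K3 K30 [e2 e20 hK3]] := barrier_expansion H H2 hE3 qP.
pose S := \sum_i normc (b i) ^+ 2 - c * th * complex.Re (\tr (barrier_hess F H Q)).
pose K := \sum_i \sum_(j | j != i) normc (((b i - b j) / (l i - l j)) ^+ 4).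
have K0 : 0 <= K by do 2!apply: sumr_ge0 => ? _; apply: normc_ge0.
rewrite -subr_le0 -/S.
have e0 : 0 < Num.min e1 e2 by rewrite lt_min e10.
apply: (@le0_of_exp_quadratic _ S (c * th * K3) K N _ e0 N0 K0) => x /andP[x0].
rewrite lt_min => /andP[xe1 xe2].
have nx : normc (x%:C : R[i]) = x by rewrite normc_real gtr0_norm.
set z : R[i] := x%:C in nx.
have obj w : normc w = x -> vander (fun i => l i + w * b i) *
    expR (N * (\sum_i normc (l i + w * b i) ^+ 2 - c * (soft_level th s + th * complex.Re (\tr (Qz w - Q))))) <=
    vander l * expR (N * (\sum_i normc (l i) ^+ 2 - c * soft_level th s)).
  by move=> hw; rewrite -lev; apply: (maxs (s' := sz w)); apply: hf; rewrite hw.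
have o1 := obj z nx; have o2 := obj _ (etrans (normc_i z) nx).
have o3 := obj _ (etrans (normcN z) nx).
have o4 := obj _ (etrans (normcN _) (etrans (normc_i z) nx)).
have hv := vander_four b z linj; rewrite -/K nx /= in hv.
pose v w := vander (fun i => l i + w * b i).
pose g w := \sum_i normc (l i + w * b i) ^+ 2
  - c * (soft_level th s + th * complex.Re (\tr (Qz w - Q))).
pose g0 := \sum_i normc (l i) ^+ 2 - c * soft_level th s.
have vge0 w : 0 <= v w * expR (N * g w) by rewrite mulr_ge0 ?vander_ge0 ?expR_ge0.
have := prod4_le (vge0 z) (vge0 _) (vge0 _) (vge0 _) o1 o2 o3 o4.
rewrite [X in X <= _]prod4_expR -[g z + _ + _ + _]/(four g z).
rewrite exprMn -expRM_natl => hprod.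
have hg : four g z = g0 *+ 4 + (4 * x ^+ 2 * S - c * th *
    complex.Re (\tr (four Qz z - (Q + (x ^+ 2)%:C *: barrier_hess F H Q) *+ 4))).
  have e1' : \sum_i normc (l i + z * b i) ^+ 2 + \sum_i normc (l i + 'i * z * b i) ^+ 2
      + \sum_i normc (l i + - z * b i) ^+ 2 + \sum_i normc (l i + - ('i * z) * b i) ^+ 2
      = (\sum_i normc (l i) ^+ 2 + x ^+ 2 * \sum_i normc (b i) ^+ 2) *+ 4.
    rewrite mulr_sumr -!big_split -sumrMnl /=; apply: eq_bigr => i _.
    by rewrite -nx -four_normc_sqr.
  have e2' : complex.Re (\tr (four Qz z - (Q + (x ^+ 2)%:C *: barrier_hess F H Q) *+ 4)) =
      complex.Re (\tr (Qz z - Q)) + complex.Re (\tr (Qz ('i * z) - Q)) +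
      complex.Re (\tr (Qz (- z) - Q)) + complex.Re (\tr (Qz (- ('i * z)) - Q))
      - 4 * (x ^+ 2 * complex.Re (\tr (barrier_hess F H Q))).
    exact: Re_tr_four.
  by rewrite {}e2'; apply: second_order_gain.
have herr : complex.Re (\tr (four Qz z - (Q + (x ^+ 2)%:C *: barrier_hess F H Q) *+ 4)) <=
    K3 * x ^+ 3.
  apply: le_trans (ler_norm _) (le_trans (Re_tr_le _) _).
  by have := hK3 z; rewrite nx => /(_ xe2).
move: hg herr hprod hv; set err := complex.Re _.
move: (four g z) (v z * _ * _ * _) => G V4 hg herr hprod hv.
have [hneg|hpos] := leP (1 - K * x ^+ 4) 0.
  apply: le_trans (_ : 0 <= 1) => //; apply: mulr_le0_ge0 => //; exact: expR_ge0.
apply: (mul_expR_le1 (exprn_gt0 4 vs) (ltW hpos) hv hprod).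
by apply: second_order_exponent hg herr; [exact: ltW | rewrite mulr_ge0 // ltW].
Qed.

End Optimum.

(** * A feasible starting state with simple spectrum *)

Lemma near0_forall (R : realType) (I : finType) (P : I -> R[i] -> Prop) :
  (forall i, near0 (P i)) -> near0 (fun z => forall i, P i z).
Proof.
move=> h; suff : near0 (fun z => forall i, i \in enum I -> P i z).
  by apply: near0_imp => z hz i; apply: hz; rewrite mem_enum.
elim: (enum I) => [|i s IH]; first exact: near0_all.
apply: near0_imp (near0_and (h i) IH) => z [h1 h2] j.
by rewrite inE => /orP[/eqP->|/h2].
Qed.

Lemma spectrum_trig (K : fieldType) n (T S X : 'M[K]_n) :
  T *m S = 1%:M -> is_trig_mx X -> spectrum (T *m X *m S) (fun i => X i i).
Proof.
move=> TS hX x; rewrite det_similar // det_trig.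
  by apply: eq_bigr => i _; rewrite !mxE eqxx mulr1n.
apply/is_trig_mxP => i j ij; rewrite !mxE (is_trig_mxP hX) // subr0.
by rewrite (_ : (i == j) = false) // -val_eqE /= ltn_eqF.
Qed.

Lemma triangularization (K : numClosedFieldType) n (A : 'M[K]_n) :
  exists T S X : 'M[K]_n, [/\ T *m S = 1%:M, is_trig_mx X & A = T *m X *m S].
Proof.
have [|P uP /= /andP[hP _]] := @cotrigonalization K n [:: A].
  by move=> X Y; rewrite !inE => /eqP-> /eqP->.
have PP := unitarymxP uP.
exists (P^t*), P, (P *m A *m P^t*); split; first exact: mulmx1C.
  by rewrite -conjymx.
by rewrite !mulmxA (mulmx1C PP) mul1mx -mulmxA (mulmx1C PP) mulmx1.
Qed.

(** After triangularization of [A], adding the distinct numbers z r i to the diagonal separates the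
    eigenvalues for every small nonzero z, with [F] as close to 0 as desired. *)
Lemma start_state (R : realType) n (A : 'M[R[i]]_n) (r : R) :
  (0 < n)%N -> r != 0 ->
  let th : R := (16 * n%:R)^-1 in
  exists s, [/\ feasible A r th s, soft_level th s <= 7 / 12 & 0 < vander (st_l s)].
Proof.
move=> n0 r0 th.
have n0R : 0 < n%:R :> R by rewrite ltr0n.
have th0 : 0 < th by rewrite invr_gt0 mulr_gt0.
have rC0 : r%:C != 0 :> R[i] by rewrite (inj_eq (@complexI _)).
have [T [S [X [TS hX eA]]]] := triangularization A.
pose Y : 'M[R[i]]_n := diagf (fun i => (i : nat)%:R).
pose F z := z *: (T *m Y *m S).
pose l z i := X i i + z * (r%:C * (i : nat)%:R).
have hspec z : spectrum (A + r%:C *: F z) (l z).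
  have -> : A + r%:C *: F z = T *m (X + z *: (r%:C *: Y)) *m S.
    rewrite eA /F mulmxDr mulmxDl -!scalemxAr -!scalemxAl !scalerA.
    by rewrite (mulrC z).
  have := @spectrum_trig _ _ T S (X + z *: (r%:C *: Y)) TS.
  have -> : (fun i => (X + z *: (r%:C *: Y)) i i) = l z.
    by apply/funext => i; rewrite !mxE eqxx mulr1n.
  apply; apply/is_trig_mxP => i j ij; rewrite !mxE (is_trig_mxP hX) //.
  by rewrite (_ : (i == j) = false) ?mulr0n ?mulr0 ?addr0 // -val_eqE /= ltn_eqF.
have hinj : near0 (fun z => z != 0 -> injective (l z)).
  have : near0 (fun z => forall p : 'I_n * 'I_n, z != 0 -> p.1 != p.2 -> l z p.1 != l z p.2).
    apply: near0_forall => -[i j] /=.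
    have w0 : i != j -> r%:C * (i : nat)%:R - r%:C * (j : nat)%:R != 0 :> R[i].
      by move=> ij; rewrite -mulrBr mulf_neq0 // subr_eq0 eqr_nat.
    set w := _ - _ in w0.
    (* Affine in z with slope [w], nonzero for distinct indices: if the constant term vanishes any
       nonzero z will do, and otherwise every z with |z| |w| below the constant term. *)
    have el z : l z i - l z j = (X i i - X j j) + z * w by rewrite /l /w; ring.
    have [a0|a0] := eqVneq (X i i - X j j) 0.
      apply: near0_all => z z0 ij.
      by rewrite -subr_eq0 el a0 add0r mulf_neq0 // w0.
    have e0 : 0 < normc (X i i - X j j) / (normc w + 1).
      rewrite divr_gt0 ?ltr_wpDl ?normc_ge0 // lt_def normc_ge0 andbT.
      by rewrite normc_eq0.
    apply: near0_imp (near0_small e0) => z hz z0 ij.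
    rewrite -subr_eq0 el addr_eq0; apply/eqP => /(congr1 (@normc _)).
    rewrite normcN normcM => ha; move: hz.
    rewrite ltr_pdivlMr ?ltr_wpDl ?normc_ge0 // ha.
    by have := normc_ge0 z; have := normc_ge0 w; lra.
  apply: near0_imp => z h z0 i j hij; apply/eqP; apply/negPn/negP => ij.
  by have := h (i, j) z0 ij; rewrite /= hij eqxx.
(* At [F = 0] the level is m + th n / m with th n = 1/16; its minimum 1/2 is attained at m = 1/4. *)
pose m : R := 1 / 4.
have m0 : 0 < m by rewrite divr_gt0.
pose Q : 'M[R[i]]_n := (4%:R : R)%:C%:M.
have QP : Q *m (m%:C%:M - (0 : 'M[R[i]]_n)^t* *m 0) = 1%:M.
  by rewrite mulmx0 subr0 -scalar_mxM -rmorphM /= /m mul1r mulfV.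
pose D z := (F z)^t* *m F z - (0 : 'M[R[i]]_n)^t* *m 0.
have hF1 : bigO 1 F by apply: bigOZ; apply: bigO_const.
have hD : bigO 1 D.
  apply: bigO_weaken (_ : 1 <= 2)%N _ => //.
  apply: bigO_ext (bigOM (bigO_adj hF1) hF1) => z.
  by rewrite /D mulmx0 subr0.
have c0 : sq_contr m (0 : 'M[R[i]]_n).
  move=> v; rewrite mul0mx /frob2 big1 ?mulr_ge0 ?frob2_ge0 ?ltW // => i _.
  by rewrite big1 // => j _; rewrite mxE normc0 expr0n.
have m1 : m <= 1 by rewrite /m; lra.
(* Lets the level move by at most 1/12, and 1/2 + 1/12 = 7/12. *)
have d0 : 0 < (12 * th)^-1 by rewrite invr_gt0 mulr_gt0.
have [e e0 he] := near0_and (near0_and hinj (sq_contr_perturb QP c0 m1 hD))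
  (near0_and (resolvent_unit QP hD) (bigO_enorm_small d0 (resolvent_first QP hD))).
pose z : R[i] := (e / 2)%:C.
have nz : normc z < e by rewrite normc_real gtr0_norm ?divr_gt0 //; lra.
have z0 : z != 0 by rewrite -normc_eq0 normc_real normr_eq0 gt_eqF // divr_gt0.
have [[h1 h2] [h3 h4]] := he z nz.
have eP : m%:C%:M - 0^t* *m (0 : 'M[R[i]]_n) - D z = m%:C%:M - (F z)^t* *m F z.
  by rewrite /D !mulmx0 !subr0.
rewrite {}eP in h3 h4.
have hlev : soft_level th (State (F z) (l z) m (invmx (m%:C%:M - (F z)^t* *m F z))) <= 7 / 12.
  rewrite /soft_level /=; move: h4; set Q' := invmx _ => h4.
  have := le_trans (ler_norm _) (le_trans (Re_tr_le _) h4).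
  have trQ : complex.Re (\tr Q) = 4 * n%:R.
    by rewrite mxtrace_scalar -(rmorphMn (real_complex R)) /= mulr_natr.
  rewrite Re_trB trQ => h5.
  have : th * (complex.Re (\tr Q') - 4 * n%:R) <= th * (12 * th)^-1.
    by rewrite ler_wpM2l // ltW.
  have -> : th * (12 * th)^-1 = 1 / 12 by field; rewrite gt_eqF.
  rewrite mulrBr.
  have -> : th * (4 * n%:R) = 1 / 4 by rewrite /th; field; rewrite gt_eqF.
  by rewrite /m; lra.
exists (State (F z) (l z) m (invmx (m%:C%:M - (F z)^t* *m F z))); split; [split| |].
- exact: hspec.
- exact: mulVmx h3.
- exact: h2.
- by apply: le_trans hlev _; lra.
- exact: hlev.
apply: prodr_gt0 => i _; apply: prodr_gt0 => j ij.
rewrite lt_def normc_ge0 andbT normc_eq0 subr_eq0 /=.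
by apply: contra_neq ij => /(h1 z0).
Qed.

(** * Operator norm and eigenvector condition number *)

Section OpNorm.
Variables (R : realType) (n : nat).
Implicit Types (M X Y : 'M[R[i]]_n) (v : 'cV[R[i]]_n).

Lemma opnorm_le M B :
  0 <= B -> (forall v, frob2 (M *m v) <= B ^+ 2 * frob2 v) -> opnorm M <= B.
Proof.
move=> B0 h; apply: ge_sup; first by case: (has_sup_opnorm M).
move=> _ [v /= hv <-].
have hv2 : frob2 v <= 1.
  by rewrite -l2norm_sqr expr_le1 // /l2norm sqrtr_ge0.
rewrite l2norm_frob2 -[leRHS]ger0_norm // -sqrtr_sqr ler_sqrt ?sqr_ge0 //.
by apply: le_trans (h v) _; rewrite ler_piMr ?sqr_ge0.
Qed.

Lemma opnorm_ge0 M : 0 <= opnorm M.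
Proof.
apply: le_trans (_ : l2norm (M *m 0) <= _); first by rewrite /l2norm sqrtr_ge0.
apply: ub_le_sup; first by case: (has_sup_opnorm M).
exists 0 => //=; rewrite l2norm_frob2.
suff -> : frob2 (0 : 'cV[R[i]]_n) = 0 by rewrite sqrtr0.
by rewrite /frob2 big1 // => i _; rewrite big1 // => j _; rewrite mxE normc0 expr0n.
Qed.

Lemma frob2_mul_opnorm M v : frob2 (M *m v) <= opnorm M ^+ 2 * frob2 v.
Proof.
have [v0|v0] := eqVneq (frob2 v) 0.
  have := frob2M M v; rewrite v0 !mulr0; exact.
have vgt : 0 < frob2 v by rewrite lt_def v0 frob2_ge0.
pose w := ((Num.sqrt (frob2 v))^-1)%:C *: v.
have sgt : 0 < Num.sqrt (frob2 v) by rewrite sqrtr_gt0.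
have ew (X : 'cV[R[i]]_n) :
    frob2 (((Num.sqrt (frob2 v))^-1)%:C *: X) = frob2 X / frob2 v.
  by rewrite frob2Z normc_real ger0_norm ?invr_ge0 ?sqrtr_ge0 // exprVn sqr_sqrtr ?frob2_ge0 // mulrC.
have hw : l2norm (M *m w) <= opnorm M.
  apply: ub_le_sup; first by case: (has_sup_opnorm M).
  exists w => //=; rewrite l2norm_frob2 /w ew divff // sqrtr1 //.
rewrite -ler_pdivrMr // -ew scalemxAr -/w -l2norm_sqr lerXn2r ?nnegrE ?opnorm_ge0 //.
by rewrite /l2norm sqrtr_ge0.
Qed.

Lemma opnorm_frob2 M : opnorm M <= Num.sqrt (frob2 M).
Proof.
apply: opnorm_le; first exact: sqrtr_ge0.
by move=> v; rewrite sqr_sqrtr ?frob2_ge0 // frob2M.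
Qed.

Lemma opnorm_eq0 M : opnorm M = 0 -> M = 0.
Proof.
move=> h; apply/matrixP => i j; rewrite mxE; apply/eqP; rewrite -normc_eq0.
have : frob2 (M *m delta_mx j (0 : 'I_1)) = 0.
  apply/eqP; rewrite eq_le frob2_ge0 andbT.
  by apply: le_trans (frob2_mul_opnorm _ _) _; rewrite h expr0n mul0r.
by move=> /frob2_eq0/matrixP/(_ i 0); rewrite -colE !mxE => ->; rewrite normc0.
Qed.

(** Young's inequality with weights. For s = r / a and t = a / r it gives the triangle inequality
    for operator norms in squared form, with constant (a + r)^2. *)
Lemma frob2D_le p q (X Y : 'M[R[i]]_(p, q)) (s t : R) : 0 < s -> s * t = 1 ->
  frob2 (X + Y) <= (1 + s) * frob2 X + (1 + t) * frob2 Y.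
Proof.
move=> s0 st; rewrite /frob2 !mulr_sumr -big_split /=; apply: ler_sum => i _.
rewrite !mulr_sumr -big_split /=; apply: ler_sum => j _; rewrite mxE.
have := le_normcD (X i j) (Y i j).
move: (normc_ge0 (X i j + Y i j)) (normc_ge0 (X i j)) (normc_ge0 (Y i j)).
move: (normc (X i j + Y i j)) (normc (X i j)) (normc (Y i j)) => c a b c0 a0 b0 hc.
apply: le_trans (_ : (a + b) ^+ 2 <= _); first by rewrite lerXn2r ?nnegrE ?addr_ge0.
have t0 : 0 < t by rewrite -(pmulr_rgt0 _ s0) st.
have : 0 <= (s * a - b) ^+ 2 * t by rewrite mulr_ge0 ?sqr_ge0 // ltW.
have -> : (s * a - b) ^+ 2 * t = (s * t) * (s * a ^+ 2) - 2 * (s * t) * a * b + t * b ^+ 2 by ring.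
by rewrite st; lra.
Qed.

End OpNorm.

Lemma kappaV_le (R : realType) n (M V W : 'M[R[i]]_n) (l : 'I_n -> R[i]) (B : R) :
  V *m W = 1%:M -> M = V *m diagf l *m W ->
  opnorm V * opnorm W <= B -> (kappaV M <= B%:E)%E.
Proof.
move=> VW eM hB; have [uV uW] := mulmx1_unit VW.
have eW : invmx V = W by rewrite -[LHS]mulmx1 -VW mulmxA mulVmx // mul1mx.
apply: le_trans (_ : (opnorm V * opnorm W)%:E <= _)%E; last by rewrite lee_fin.
apply: ereal_inf_lbound; exists V, (diagf l); rewrite eW.
by split; [exact: uV | exact: diag_mx_is_diag | exact: eM | ].
Qed.

(* Rescaling the eigenvectors balances the Frobenius norms of [V] and its inverse. *)
Lemma kappaV_balanced (R : realType) n (M V W : 'M[R[i]]_n) (l : 'I_n -> R[i]) :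
  V *m W = 1%:M -> M = V *m diagf l *m W ->
  (kappaV M <= (\sum_i Num.sqrt (frob2 (col i V) * frob2 (row i W)))%:E)%E.
Proof.
move=> VW eM; have WV := mulmx1C VW.
pose v i := frob2 (col i V); pose w i := frob2 (row i W).
have WVi i : (W *m V) i i != 0 by rewrite WV mxE eqxx oner_eq0.
have v0 i : 0 < v i.
  rewrite lt_def frob2_ge0 andbT; apply: contra (WVi i) => /eqP/frob2_eq0 h.
  rewrite mxE big1 // => k _; have := congr1 (fun X : 'cV_n => X k 0) h.
  by rewrite !mxE => ->; rewrite mulr0.
have w0 i : 0 < w i.
  rewrite lt_def frob2_ge0 andbT; apply: contra (WVi i) => /eqP/frob2_eq0 h.
  rewrite mxE big1 // => k _; have := congr1 (fun X : 'rV_n => X 0 k) h.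
  by rewrite !mxE => ->; rewrite mul0r.
(* With y_i^2 = |w_i| / |v_i|, the vectors y_i v_i and w_i / y_i have the same squared length |v_i|
   |w_i|. *)
pose y i := Num.sqrt (Num.sqrt (w i) / Num.sqrt (v i)).
have y0 i : 0 < y i by rewrite sqrtr_gt0 divr_gt0 ?sqrtr_gt0.
have y2 i : y i ^+ 2 = Num.sqrt (w i) / Num.sqrt (v i).
  by rewrite sqr_sqrtr // divr_ge0 ?sqrtr_ge0.
have sv i : 0 < Num.sqrt (v i) by rewrite sqrtr_gt0.
have sw i : 0 < Num.sqrt (w i) by rewrite sqrtr_gt0.
have svv i : v i = Num.sqrt (v i) * Num.sqrt (v i) by rewrite -expr2 sqr_sqrtr ?ltW.
have sww i : w i = Num.sqrt (w i) * Num.sqrt (w i) by rewrite -expr2 sqr_sqrtr ?ltW.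
pose X := diagf (fun i => (y i)%:C); pose Y := diagf (fun i => ((y i)^-1)%:C).
have XY : X *m Y = 1%:M.
  apply/matrixP => i j; rewrite /X /Y mul_diag_mx !mxE.
  have [->|_] := eqVneq i j; last by rewrite !mulr0n mulr0.
  by rewrite !mulr1n -rmorphM /= mulfV // gt_eqF.
have XlY : X *m diagf l *m Y = diagf l.
  have -> : X *m diagf l = diagf l *m X.
    apply/matrixP => i j; rewrite /X !mul_diag_mx !mxE.
    have [->|_] := eqVneq i j; last by rewrite !mulr0n !mulr0.
    by rewrite !mulr1n mulrC.
  by rewrite -mulmxA XY mulmx1.
have hV : frob2 (V *m X) = \sum_i Num.sqrt (v i * w i).
  rewrite frob2_col; apply: eq_bigr => i _.
  have -> : col i (V *m X) = (y i)%:C *: col i V.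
    by apply/colP => k; rewrite /X mul_mx_diag !mxE mulrC.
  rewrite frob2Z normc_real ger0_norm ?(ltW (y0 i)) // y2 -/(v i) {2}svv sqrtrM ?ltW //.
  by field; rewrite gt_eqF.
have hW : frob2 (Y *m W) = \sum_i Num.sqrt (v i * w i).
  apply: eq_bigr => i _.
  have -> : \sum_j normc ((Y *m W) i j) ^+ 2 = (y i) ^- 2 * w i.
    rewrite /w /frob2 big_ord1 mulr_sumr; apply: eq_bigr => j _.
    by rewrite /Y mul_diag_mx !mxE normcM exprMn normc_real ger0_norm ?invr_ge0 ?(ltW (y0 i)) // exprVn.
  by rewrite y2 invf_div {2}sww sqrtrM ?ltW //; field; rewrite gt_eqF.
apply: (@kappaV_le _ _ _ (V *m X) (Y *m W) l).
- by rewrite mulmxA -(mulmxA V) XY mulmx1.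
- by rewrite {1}eM -[in LHS]XlY !mulmxA.
apply: le_trans (_ : Num.sqrt (frob2 (V *m X)) * Num.sqrt (frob2 (Y *m W)) <= _).
  by rewrite ler_pM ?opnorm_ge0 ?opnorm_frob2.
by rewrite hV hW -expr2 sqr_sqrtr ?sumr_ge0 // => i _; apply: sqrtr_ge0.
Qed.

(** * The Laplacian bound and the final estimate *)

(** The hypotheses reduce the claim to 2 t - 3 t^2 / (16 n) <= 5 n for t <= 4 n, a bound that comes
    from th q <= 1. The left side increases up to t = 16 n / 3, so its maximum is at 4 n, where it
    equals 8 n - 3 n. *)
Lemma barrier_arith (R : realType) (n m t q c th : R) :
  0 < n -> th = (16 * n)^-1 -> 0 <= c -> 0 <= m -> 0 <= t -> t ^+ 2 <= n * q ->
  th * q <= 1 -> m + th * t <= 1 ->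
  c * th * (2 * m * t * q - t ^+ 2) <= 5 * n * c.
Proof.
move=> n0 thE c0 m0 t0 htq hq hm.
have th0 : 0 < th by rewrite thE invr_gt0 mulr_gt0.
have nth : n * th = 1 / 16 by rewrite thE; field; rewrite gt_eqF.
have t2 : t ^+ 2 <= (4 * n) ^+ 2.
  have : th * t ^+ 2 <= n by apply: le_trans (_ : n * (th * q) <= _); nra.
  have -> : th * t ^+ 2 = t ^+ 2 / (16 * n) by rewrite thE mulrC.
  by rewrite ler_pdivrMr ?mulr_gt0 //; lra.
have t4 : t <= 4 * n by rewrite -(@ler_pXn2r _ 2) ?nnegrE // mulr_ge0 // ltW.
have h1 : th * (2 * m * t * q) <= 2 * m * t.
  have -> : th * (2 * m * t * q) = (2 * m * t) * (th * q) by ring.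
  by rewrite ler_piMr // !mulr_ge0.
have h2 : m * t <= (1 - th * t) * t by rewrite ler_wpM2r //; lra.
have h3 : 2 * t - 3 * th * t ^+ 2 <= 5 * n.
  have -> : 3 * th * t ^+ 2 = 3 * t ^+ 2 / (16 * n) by rewrite thE; field; rewrite gt_eqF.
  rewrite lerBlDr -lerBlDl ler_pdivlMr ?mulr_gt0 //.
  have : 0 <= (4 * n - t) * (20 * n - 3 * t) by rewrite mulr_ge0 //; lra.
  lra.
rewrite -mulrA mulrC; apply: ler_wpM2r => //.
move: h1 h2 h3; rewrite expr2; lra.
Qed.

Section Main.
Variables (R : realType) (n : nat) (A : 'M[R[i]]_n) (a r : R).
Hypotheses (n0 : (0 < n)%N) (a0 : 0 < a) (r0 : 0 < r).
Hypothesis hA : forall v : 'cV[R[i]]_n, frob2 (A *m v) <= a ^+ 2 * frob2 v.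

Let th : R := (16 * n%:R)^-1.
(** The sum of |lambda_i|^2 is at most n (a + r)^2 = c / 3. The factor 3 is large enough for 1 - 1/3
    to exceed the starting level 7/12, and small enough for the final constant 15 to stay below
    4^2. *)
Let c : R := 3 * n%:R * (a + r) ^+ 2.

Let n0R : 0 < n%:R :> R. Proof. by rewrite ltr0n. Qed.
Let th0 : 0 < th. Proof. by rewrite invr_gt0 mulr_gt0. Qed.
Let c0 : 0 < c. Proof. by rewrite mulr_gt0 ?mulr_gt0 ?exprn_gt0 ?addr_gt0. Qed.

Lemma eigenvalue_bound s i : feasible A r th s -> normc (st_l s i) <= a + r.
Proof.
move=> fs; have /andP[_ m1] := feasible_m n0 th0 fs; case: fs => [h1 _ h3 _].
have ar0 : 0 <= a + r by rewrite addr_ge0 // ltW.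
rewrite -(@ler_pXn2r _ 2) ?nnegrE ?normc_ge0 //; apply: spectrum_bound h1 _ => v.
rewrite mulmxDl -scalemxAl.
have s0 : 0 < r / a by rewrite divr_gt0.
have st : r / a * (a / r) = 1 by rewrite mulrA divfK ?gt_eqF // mulfV // gt_eqF.
apply: le_trans (frob2D_le _ _ s0 st) _.
rewrite frob2Z normc_real ger0_norm ?(ltW r0) //.
have hF : frob2 (st_F s *m v) <= frob2 v.
  by apply: le_trans (h3 v) _; rewrite ler_piMl ?frob2_ge0.
have h4 : (1 + r / a) * frob2 (A *m v) <= (1 + r / a) * (a ^+ 2 * frob2 v).
  by rewrite ler_wpM2l // addr_ge0 // ltW.
have h5 : (1 + a / r) * (r ^+ 2 * frob2 (st_F s *m v)) <= (1 + a / r) * (r ^+ 2 * frob2 v).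
  rewrite ler_wpM2l ?addr_ge0 ?divr_ge0 ?(ltW a0) ?(ltW r0) //.
  by rewrite ler_wpM2l ?sqr_ge0.
apply: le_trans (lerD h4 h5) _.
have -> : (1 + r / a) * (a ^+ 2 * frob2 v) + (1 + a / r) * (r ^+ 2 * frob2 v)
  = (a + r) ^+ 2 * frob2 v by field; rewrite !gt_eqF.
exact: lexx.
Qed.

(** If the level reached 1, the exponent would be at most N (c/3 - c) = - 8 N c / 12, while the
    starting state has at least - 7 N c / 12. The gap N c / 12 outweighs the ratio of discriminants,
    so the constraint is inactive and all directions are open to variation. *)
Lemma interior_maximizer : exists N s, [/\ 0 < N, feasible A r th s, soft_level th s < 1,
  0 < vander (st_l s) &
  forall s', feasible A r th s' -> objective th c N s' <= objective th c N s].
Proof.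
have ar0 : 0 < a + r by rewrite addr_gt0.
have [s0 [f0 u0 v0]] := start_state A n0 (lt0r_neq0 r0).
pose K : R := \prod_(i < n) \prod_(j < n | j != i) (2 * (a + r)).
have K0 : 0 < K by do 2!apply: prodr_gt0 => ? _; rewrite mulr_gt0.
have vK s : feasible A r th s -> vander (st_l s) <= K.
  move=> fs; apply: ler_prod => i _; rewrite prodr_ge0 => [|? _]; last exact: normc_ge0.
  apply: ler_prod => j _; rewrite normc_ge0 /=.
  apply: le_trans (le_normcD _ _) _; rewrite normcN.
  by have := eigenvalue_bound i fs; have := eigenvalue_bound j fs; lra.
(* Makes N c / 12 equal to the largest possible discriminant ratio, which exp x >= 1 + x then
   beats. *)
pose N := 12 / c * (K / vander (st_l s0)).
have N0 : 0 < N by rewrite mulr_gt0 ?divr_gt0.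
have [s fs maxs] := maximizer_exists c N n0 th0 f0.
exists N, s.
have vs : 0 < vander (st_l s).
  rewrite lt_def vander_ge0 andbT; apply/eqP => vs0.
  have := maxs s0 f0; rewrite /objective vs0 mul0r leNgt.
  by rewrite mulr_gt0 ?expR_gt0.
split => //; rewrite ltNge; apply/negP => u1.
have fsum : \sum_i normc (st_l s i) ^+ 2 <= c / 3.
  apply: le_trans (_ : \sum_(i < n) (a + r) ^+ 2 <= _).
    by apply: ler_sum => i _; rewrite lerXn2r ?nnegrE ?normc_ge0 ?(ltW ar0) // eigenvalue_bound.
  by rewrite sumr_const card_ord /c -mulr_natr; lra.
have f0sum : 0 <= \sum_i normc (st_l s0 i) ^+ 2 by apply: sumr_ge0 => i _; apply: sqr_ge0.
have := maxs s0 f0; rewrite /objective => hobj.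
have hK : vander (st_l s0) * expR (N * (- c * (7 / 12))) <= K * expR (N * (- c * (8 / 12))).
  apply: le_trans (le_trans hobj _).
    rewrite ler_pM2l // ler_expR ler_pM2l //.
    have : c * soft_level th s0 <= c * (7 / 12) by rewrite ler_pM2l.
    lra.
  rewrite ler_pM ?vander_ge0 ?expR_ge0 ?vK // ler_expR ler_pM2l //.
  have : c * 1 <= c * soft_level th s by rewrite ler_pM2l.
  lra.
have hNc : N * c / 12 = K / vander (st_l s0) by rewrite /N; field; rewrite !gt_eqF.
have : vander (st_l s0) * expR (N * c / 12) <= K.
  rewrite -(ler_pM2r (expR_gt0 (N * (- c * (8 / 12))))) -[X in X <= _]mulrA -expRD.
  apply: le_trans hK; rewrite ler_pM2l // ler_expR; lra.
have : 1 + N * c / 12 <= expR (N * c / 12) by apply: expR_ge1Dx.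
rewrite -(ler_pM2l v0) => h1 h2; have := le_trans h1 h2.
by rewrite hNc mulrDr mulr1 mulrCA mulfV ?gt_eqF // mulr1 gerDr leNgt v0.
Qed.

Lemma perturbation_condition : exists E : 'M[R[i]]_n, opnorm E <= r /\
  (kappaV (A + E) <= (4 * (n%:R `^ (3 / 2)) * (a + r) / r)%:E)%E.
Proof.
have [N [s [N0 fs ls vs maxs]]] := interior_maximizer.
have /andP[m0 m1] := feasible_m n0 th0 fs.
have [hspec QP hc _] := fs.
have linj := vander_gt0_inj vs.
have [W uW MV] := spectrum_diagonalization hspec linj.
set V := invmx W in MV; have WV : W *m V = 1%:M by rewrite mulmxV.
have VW : V *m W = 1%:M by rewrite mulVmx.
exists (r%:C *: st_F s); split.
  apply: opnorm_le; first exact: ltW.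
  move=> v; rewrite -scalemxAl frob2Z normc_real ger0_norm ?(ltW r0) //.
  rewrite ler_wpM2l ?sqr_ge0 //; apply: le_trans (hc v) _.
  by rewrite ler_piMl ?frob2_ge0.
apply: le_trans (kappaV_balanced VW MV) _; rewrite lee_fin.
set Q := st_Q s in QP; set F := st_F s in QP hc MV; set m := st_m s in QP m0 m1 hc.
pose t := complex.Re (\tr Q); pose q := frob2 Q.
have trQ : \tr Q = t%:C := resolvent_trE QP.
have trQQ : \tr (Q *m Q) = q%:C by rewrite -{1}(resolvent_adj QP) -frob2_tr.
have r0' : r != 0 by rewrite gt_eqF.
have dir j k : \sum_i normc ((W *m (r%:C *: delta_mx j k) *m V) i i) ^+ 2 <=
    c * th * complex.Re (\tr (barrier_hess F (delta_mx j k) Q)).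
  exact: (optimal_direction n0 th0 c0 N0 fs ls vs maxs (delta_mx j k) r0' WV MV).
have sumT : \sum_j \sum_k complex.Re (\tr (barrier_hess F (delta_mx j k) Q)) =
    2 * m * t * q - t ^+ 2.
  have -> : \sum_j \sum_k complex.Re (\tr (barrier_hess F (delta_mx j k) Q)) =
      complex.Re (\sum_j \sum_k \tr (barrier_hess F (delta_mx j k) Q)).
    by rewrite raddf_sum; apply: eq_bigr => j _; rewrite raddf_sum.
  rewrite (barrier_hess_sum QP) trQ trQQ.
  by rewrite -[2]/(2%:R) -(rmorph_nat (real_complex R)) -!rmorphM -rmorphXn -rmorphB.
pose w i := frob2 (row i W); pose v i := frob2 (col i V).
(* The i-th diagonal entry of W E_jk V is [W i j * V k i], so the sum over [j] and [k] factors into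
   the squared lengths of a left and a right eigenvector. *)
have sumL : \sum_j \sum_k \sum_i normc ((W *m (r%:C *: delta_mx j k) *m V) i i) ^+ 2 =
    r ^+ 2 * \sum_i v i * w i.
  have e j k i : normc ((W *m (r%:C *: delta_mx j k) *m V) i i) ^+ 2 =
      r ^+ 2 * (normc (W i j) ^+ 2 * normc (V k i) ^+ 2).
    have -> : (W *m (r%:C *: delta_mx j k) *m V) i i = r%:C * (W i j * V k i).
      rewrite -scalemxAr -scalemxAl mxE; congr (_ * _).
      rewrite -(mul_delta_mx (0 : 'I_1)) mulmxA -colE -mulmxA -rowE.
      by rewrite mxE big_ord1 !mxE.
    by rewrite !normcM normc_real !exprMn real_normK ?num_real.
  have wE i : w i = \sum_j normc (W i j) ^+ 2.
    by rewrite /w /frob2 big_ord1; apply: eq_bigr => j _; rewrite mxE.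
  have vE i : v i = \sum_k normc (V k i) ^+ 2.
    by rewrite /v /frob2; apply: eq_bigr => k _; rewrite big_ord1 mxE.
  rewrite (eq_bigr (fun j => \sum_i \sum_k r ^+ 2 * (normc (W i j) ^+ 2 * normc (V k i) ^+ 2))).
    rewrite exchange_big /= mulr_sumr; apply: eq_bigr => i _.
    rewrite wE vE mulrC [X in _ = X * _]mulrC mulr_suml mulr_suml; apply: eq_bigr => j _.
    rewrite mulr_sumr mulr_suml; apply: eq_bigr => k _.
    by rewrite [LHS]mulrC.
  move=> j _; rewrite exchange_big /=; apply: eq_bigr => i _; apply: eq_bigr => k _.
  exact: e.
have hsum : r ^+ 2 * \sum_i v i * w i <= 5 * n%:R * c.
  apply: le_trans (_ : c * th * (2 * m * t * q - t ^+ 2) <= _).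
    rewrite -sumL -sumT mulr_sumr; apply: ler_sum => j _.
    by rewrite mulr_sumr; apply: ler_sum => k _; apply: dir.
  apply: barrier_arith => //.
  - exact: ltW.
  - exact: resolvent_tr_ge0 QP hc.
  - exact: resolvent_tr_sqr.
  - exact: optimal_mult th0 c0 N0 fs ls vs maxs.
  - by move: ls; rewrite /soft_level -/m -/Q -/t => /ltW.
have B0 : 0 <= 4 * (n%:R `^ (3 / 2)) * (a + r) / r.
  by rewrite divr_ge0 ?(ltW r0) // mulr_ge0 ?addr_ge0 ?(ltW a0) ?(ltW r0) // mulr_ge0 ?powR_ge0.
have S0 : 0 <= \sum_i Num.sqrt (v i * w i) by apply: sumr_ge0 => i _; apply: sqrtr_ge0.
rewrite -(@ler_pXn2r _ 2) ?nnegrE //.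
(* The factor 1 prepares Cauchy-Schwarz against the constant vector, at the cost of a factor n. *)
rewrite (eq_bigr (fun i => Num.sqrt (v i * w i) * 1)) => [|i _]; last by rewrite mulr1.
apply: le_trans (sum_cauchy_schwarz _ _) _.
rewrite (eq_bigr (fun i => v i * w i)) => [|i _]; last first.
  by rewrite sqr_sqrtr // mulr_ge0 ?frob2_ge0.
rewrite expr1n sumr_const card_ord.
have n3 : (n%:R `^ (3 / 2)) ^+ 2 = n%:R ^+ 3 :> R.
  by rewrite -powR_mulrn ?powR_ge0 // -powRrM -powR_mulrn //; congr (_ `^ _); field.
rewrite exprMn exprMn exprMn n3 exprVn ler_pdivlMr ?exprn_gt0 //.
(* The right side is 15 n^3 (a + r)^2; the nonnegative term that follows fills the gap to 16. *)
have : n%:R * (r ^+ 2 * \sum_i v i * w i) <= n%:R * (5 * n%:R * c) by rewrite ler_wpM2l.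
have : 0 <= n%:R ^+ 3 * (a + r) ^+ 2 :> R by apply: mulr_ge0; [exact: exprn_ge0 | exact: sqr_ge0].
by rewrite /c; move: (\sum_(i < n) _) (n%:R : R) => x y; lra.
Qed.

End Main.

Unset Implicit Arguments.
Theorem theorem1p1 (R : realType) (n : nat) (hn : (0 < n)%N)
    (A : 'M[R[i]]_n) (delta : R) (hdelta : 0 < delta < 1) :
  exists E : 'M[R[i]]_n,
    opnorm E <= delta * opnorm A /\
    (kappaV (A + E) <= (4 * n%:R `^ (3 / 2) * (1 + 1 / delta))%:E)%E.
Proof.
have /andP[d0 _] := hdelta.
(* Here the radius [delta * opnorm A] would be 0, but [A = 0] is already diagonal and [E = 0]
   serves. *)
have [a0|a0] := eqVneq (opnorm A) 0.
  have one_le : 1 <= 4 * n%:R `^ (3 / 2) * (1 + 1 / delta).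
    have h1 : 1 <= n%:R `^ (3 / 2) :> R.
      by rewrite -[leLHS](powRr0 (n%:R : R)) ler_powR ?ler1n // divr_ge0.
    have h2 : 0 < 1 / delta by rewrite divr_gt0.
    nra.
  exists 0; split.
    rewrite a0 mulr0; apply: opnorm_le => // v; rewrite mul0mx.
    have := frob2M (0 : 'M[R[i]]_n) v; rewrite mul0mx => h.
    by apply: le_trans h _; rewrite expr0n mul0r /frob2 big1 ?mul0r // => i _; rewrite big1 // => j _; rewrite mxE normc0 expr0n.
  rewrite (opnorm_eq0 a0) addr0.
  apply: (@kappaV_le _ _ _ 1%:M 1%:M (fun=> 0)); first exact: mulmx1.
    by rewrite mulmx1 mul1mx; apply/matrixP => i j; rewrite !mxE mul0rn.
  have h1 : opnorm (1%:M : 'M[R[i]]_n) <= 1.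
    by apply: opnorm_le => // v; rewrite mul1mx expr1n mul1r.
  apply: le_trans one_le; apply: mulr_ile1; rewrite ?opnorm_ge0 //.
have a_gt0 : 0 < opnorm A by rewrite lt_def a0 opnorm_ge0.
have r0 : 0 < delta * opnorm A by rewrite mulr_gt0.
have [E [hE hk]] := perturbation_condition hn a_gt0 r0 (frob2_mul_opnorm A).
exists E; split => //; apply: le_trans hk _; rewrite lee_fin le_eqVlt; apply/orP; left.
(* With a = [opnorm A] and r = delta a, the quotient (a + r) / r is 1 + 1 / delta. *)
by apply/eqP; field; rewrite a0 gt_eqF.
Qed.
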